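(* For all fixed $x\in\mathbb{C}$ with $|x|<1$ and $s\in\mathbb{C}$, as $n\to\infty$, $$s\sum_{m=1}^nC_m^{(n)}\,\mathrm{Log}(1-x^m)\xrightarrow{d}s\sum_{m=1}^\infty Y_m\,\mathrm{Log}(1-x^m)$$ and $$Z_n^s(x)\xrightarrow{d}Z_\infty^s(x).$$
   Context: For a uniformly random permutation in $S_n$, $C_m^{(n)}$ is its number of cycles of length $m$. $(Y_m)_{m\ge1}$ are independent random variables, $Y_m$ Poisson distributed with $\mathbb{E}[Y_m]=\frac1m$. $\mathrm{Log}$ is the principal branch of the logarithm, and complex powers are defined by it. $Z_n^s(x):=\prod_{m=1}^n(1-x^m)^{sC_m^{(n)}}$ and $Z_\infty^s(x):=\prod_{m=1}^\infty(1-x^m)^{sY_m}$ (the infinite sum and product converge almost surely). $\xrightarrow{d}$ denotes convergence in distribution of complex-valued random variables. *)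

(* Defs.v *)
From HB Require Import structures.
From mathcomp Require Import all_boot all_order all_algebra all_fingroup.
From mathcomp Require Import finmap.
From mathcomp Require Import all_classical all_reals all_analysis.
From mathcomp Require Import complex.

Set Implicit Arguments.
Unset Strict Implicit.
Unset Printing Implicit Defensive.

Import Order.TTheory GRing.Theory Num.Theory numFieldNormedType.Exports.

Local Open Scope classical_set_scope.
Local Open Scope ring_scope.
Local Open Scope complex_scope.

(* The complex numbers are R[i]; the topology of the complex plane is the one
   induced by the complex modulus, which the library attaches to R[i]^o. *)

Section complex_functions.
Variable R : realType.
Implicit Types z w : R[i].

(* Principal argument, in ]-pi, pi]; the value at 0 is irrelevant. *)
Definition carg z : R :=
  let t := acos (complex.Re z / Normc.normc z) in
  if 0 <= complex.Im z then t else - t.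

Definition cLog z : R[i] := ln (Normc.normc z) +i* carg z.

Definition cexp z : R[i] :=
  (expR (complex.Re z))%:C * (cos (complex.Im z) +i* sin (complex.Im z)).

Definition cpow z w : R[i] := cexp (w * cLog z).

End complex_functions.

Section probability_notions.
Variable R : realType.

Definition cvg_in_distribution (V : topologicalType)
    (d : nat -> measure_display) (T : forall n, measurableType (d n))
    (P : forall n, probability (T n) R) (X : forall n, T n -> V)
    (d' : measure_display) (T' : measurableType d')
    (P' : probability T' R) (X' : T' -> V) : Prop :=
  forall f : V -> R, continuous f -> bounded_fun f ->
    ('E_(P n)[f \o X n])%E @[n --> \oo] --> ('E_P'[f \o X'])%E.

Definition mutually_independent (I : choiceType) (D : set I)
    (d : measure_display) (T : measurableType d) (P : probability T R)
    (d' : measure_display) (T' : measurableType d')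
    (Y : I -> {RV P >-> T'}) : Prop :=
  forall (J : {fset I}) (A : I -> set T'),
    [set` J] `<=` D -> (forall i, measurable (A i)) ->
    P (\bigcap_(i in [set` J]) (Y i @^-1` A i)) =
    (\prod_(i <- J) P (Y i @^-1` A i))%E.

Definition poisson_distributed (d : measure_display) (T : measurableType d)
    (P : probability T R) (Y : {RV P >-> nat}) (rate : R) : Prop :=
  forall k : nat, P (Y @^-1` [set k]) = (poisson_pmf rate k)%:E.

Definition uniform_permutation (n : nat) (d : measure_display)
    (T : measurableType d) (P : probability T R) (sigma : T -> 'S_n) : Prop :=
  forall p : 'S_n, measurable (sigma @^-1` [set p]) /\
    P (sigma @^-1` [set p]) = ((n`!%:R)^-1)%:E.

End probability_notions.

(* Fixed points are the singletons of porbits p, i.e. the cycles of length 1. *)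
Definition ncycles (n : nat) (p : 'S_n) (m : nat) : nat :=
  #|[set c in porbits p | #|c| == m]|.

Section log_sums_and_products.
Variable R : realType.
Implicit Types (x s : R[i]) (c : nat -> nat) (n : nat).

Definition log_sum x c n : R[i]^o :=
  \sum_(1 <= m < n.+1) (c m)%:R * cLog (1 - x ^+ m).

Definition pow_prod s x c n : R[i]^o :=
  \prod_(1 <= m < n.+1) cpow (1 - x ^+ m) (s * (c m)%:R).

(* The infinite sum and product are limits of partial ones; on the (null)
   event where these diverge, lim takes an arbitrary constant value. *)
Definition log_series x c : R[i]^o := lim (log_sum x c n @[n --> \oo]).

Definition pow_infprod s x c : R[i]^o := lim (pow_prod s x c n @[n --> \oo]).

End log_sums_and_products.

(* Main.v *)
(* Let C be the cycle counts of a uniform permutation of n points. Building the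
   permutation one point at a time (Chinese restaurant process) gives, by
   induction on n, both n E_n[g(C)] = sum_{k=1}^n E_{n-k}[g(C + e_k)] and the
   Palm formula m E_n[C_m g(C)] = E_{n-m}[g(C + e_m)] for m <= n. The Palm
   formula shows that P_n(C_i = c_i for i <= M) equals
   prod_{i<=M} 1/(i^{c_i} c_i!) times a_{n - sum i c_i}, where a_k is the
   probability that a permutation of k points has no cycle of length <= M. Hence
   the law of (C_1, ..., C_M) has, with respect to that of the independent
   Poisson variables (Y_1, ..., Y_M), the bounded density
   e^{1 + 1/2 + ... + 1/M} a_{n - sum i Y_i}. The sequence a_k converges because
   k a_k = a_0 + ... + a_{k-M-1}, and since the densities have mean 1 their limit
   is 1; dominated convergence yields convergence in law of (C_1, ..., C_M), and
   Fatou's lemma yields E[Y_m] <= 1/m. As E_n[C_m] <= 1/m as well and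
   |Log(1 - x^m)| = O(|x|^m), truncating the sums at M costs little uniformly in
   n, by uniform continuity of the test function on bounded sets. Finally
   Z_n^s(x) is the exponential of the first sum. *)

Require Import Defs.
From HB Require Import structures.
From mathcomp Require Import all_boot all_order all_algebra all_fingroup.
From mathcomp Require Import finmap.
From mathcomp Require Import all_classical all_reals all_analysis.
From mathcomp Require Import measurable_realfun complex.
From mathcomp Require Import zify ring lra.

Set Implicit Arguments.
Unset Strict Implicit.
Unset Printing Implicit Defensive.

Import Order.TTheory GRing.Theory Num.Theory numFieldNormedType.Exports.

Local Open Scope classical_set_scope.
Local Open Scope ring_scope.
Local Open Scope complex_scope.

(** * Cycle counts under insertion of a point *)

Definition incr_at (k : nat) (c : nat -> nat) : nat -> nat :=
  fun m => (c m + (m == k))%N.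

(** The new point is [ord0]. Products of permutations act from left to right, so [k = ord0] makes it
    a fixed point, and [k = lift ord0 j] puts it between [j] and [q j] on the cycle of [j]. *)
Definition insert_perm (n : nat) (q : 'S_n) (k : 'I_n.+1) : 'S_n.+1 :=
  (tperm ord0 k * lift_perm ord0 ord0 q)%g.

(** Contracts the new point onto [j], which turns the cycles of the enlarged permutation back into
    those of [q]. *)
Definition collapse (n : nat) (j : 'I_n) (z : 'I_n.+1) : 'I_n :=
  odflt j (unlift ord0 z).

Lemma collapse0 n (j : 'I_n) : collapse j ord0 = j.
Proof. by rewrite /collapse unlift_none. Qed.

Lemma collapse_lift n (j i : 'I_n) : collapse j (lift ord0 i) = i.
Proof. by rewrite /collapse liftK. Qed.

Lemma insert_perm0 n (q : 'S_n) j :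
  insert_perm q (lift ord0 j) ord0 = lift ord0 (q j).
Proof. by rewrite permM tpermL lift_perm_lift. Qed.

Lemma insert_perm_last n (q : 'S_n) j :
  insert_perm q (lift ord0 j) (lift ord0 j) = ord0.
Proof. by rewrite permM tpermR lift_perm_id. Qed.

Lemma insert_perm_lift n (q : 'S_n) j i : i != j ->
  insert_perm q (lift ord0 j) (lift ord0 i) = lift ord0 (q i).
Proof.
move=> ij; rewrite permM tpermD ?lift_perm_lift ?neq_lift //.
by rewrite (inj_eq (@lift_inj _ _)) eq_sym.
Qed.

Lemma insert_perm_fix0 n (q : 'S_n) : insert_perm q ord0 ord0 = ord0.
Proof. by rewrite permM tperm1 perm1 lift_perm_id. Qed.

Lemma insert_perm_fix_lift n (q : 'S_n) i :
  insert_perm q ord0 (lift ord0 i) = lift ord0 (q i).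
Proof. by rewrite permM tperm1 perm1 lift_perm_lift. Qed.

Lemma porbit_closed (T : finType) (p : {perm T}) (A : {pred T}) x :
  (forall y, y \in A -> p y \in A) -> x \in A ->
  {subset porbit p x <= A}.
Proof.
move=> pA xA y /porbitP[i ->]; elim: i => [|i IH]; first by rewrite perm1.
by rewrite expgSr permM; apply: pA.
Qed.

Lemma porbit_trans (T : finType) (p : {perm T}) x y z :
  y \in porbit p x -> z \in porbit p y -> z \in porbit p x.
Proof. by rewrite -eq_porbit_mem => /eqP <-. Qed.

Lemma porbit_step (T : finType) (p : {perm T}) x : p x \in porbit p x.
Proof. by have := mem_porbit p 1 x; rewrite expg1. Qed.

(** Under [collapse j], a step of the enlarged permutation is a step of [q] or no move at all;
    conversely, a step of [q] lifts to one step, or to two passing through the new point. *)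
Lemma porbit_insert_perm n (q : 'S_n) j z y :
  (y \in porbit (insert_perm q (lift ord0 j)) z) =
  (collapse j y \in porbit q (collapse j z)).
Proof.
set p := insert_perm _ _.
have p0 : p ord0 = lift ord0 (q j) by exact: insert_perm0.
have pj : p (lift ord0 j) = ord0 by exact: insert_perm_last.
have pl i : i != j -> p (lift ord0 i) = lift ord0 (q i).
  exact: insert_perm_lift.
have lastP : ord0 \in porbit p (lift ord0 j) by rewrite -{1}pj porbit_step.
have liftP u : lift ord0 (collapse j u) \in porbit p u.
  case: (unliftP ord0 u) => [i ->|->]; first by rewrite collapse_lift porbit_id.
  by rewrite collapse0 porbit_sym.
have stepP i : lift ord0 (q i) \in porbit p (lift ord0 i).
  have [->|/pl <-] := eqVneq i j; last exact: porbit_step.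
  by apply: (porbit_trans lastP); rewrite -p0 porbit_step.
apply/idP/idP.
  have -> : (collapse j y \in porbit q (collapse j z)) =
    (y \in [pred u | collapse j u \in porbit q (collapse j z)]) by [].
  apply: porbit_closed => [u|]; rewrite !inE; last exact: porbit_id.
  case: (unliftP ord0 u) => [i ->|->].
    have [->|/pl ->] := eqVneq i j; first by rewrite pj collapse0 collapse_lift.
    by rewrite !collapse_lift => /porbit_trans; apply; exact: porbit_step.
  rewrite p0 !collapse_lift collapse0 => /porbit_trans; apply.
  exact: porbit_step.
move=> yz.
suff: lift ord0 (collapse j y) \in porbit p (lift ord0 (collapse j z)).
  move=> h; apply: (porbit_trans (liftP z)); apply: (porbit_trans h).
  by rewrite porbit_sym.
have -> : (lift ord0 (collapse j y) \in porbit p (lift ord0 (collapse j z))) =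
  (collapse j y \in [pred u | lift ord0 u \in porbit p (lift ord0 (collapse j z))])
  by [].
apply: porbit_closed yz => [u|]; rewrite !inE; last exact: porbit_id.
by move/porbit_trans; apply; exact: stepP.
Qed.

(** [collapse j] is one-to-one except over [j], whose fibre also holds the new point. *)
Lemma card_porbit_insert n (q : 'S_n) j z :
  #|porbit (insert_perm q (lift ord0 j)) z| =
  (#|porbit q (collapse j z)| + (j \in porbit q (collapse j z)))%N.
Proof.
rewrite -!sum1_card big_mkcond [in RHS]big_mkcond /= big_ord_recl /= addnC.
congr (_ + _)%N; last by rewrite porbit_insert_perm collapse0; case: ifP.
by apply: eq_bigr => i _; rewrite porbit_insert_perm collapse_lift.
Qed.

Lemma porbit_insert_fix0 n (q : 'S_n) :
  porbit (insert_perm q ord0) ord0 = [set ord0]%SET.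
Proof.
apply/setP => y; rewrite !inE; apply/idP/eqP => [|->]; last exact: porbit_id.
move=> /(@porbit_closed _ _ (pred1 ord0)) h; apply/eqP; apply: h; last by rewrite inE.
by move=> u; rewrite !inE => /eqP ->; rewrite insert_perm_fix0.
Qed.

Lemma mem_porbit_insert_fix n (q : 'S_n) i k :
  (lift ord0 k \in porbit (insert_perm q ord0) (lift ord0 i)) =
  (k \in porbit q i).
Proof.
set p := insert_perm q ord0.
apply/idP/idP.
  move=> /(@porbit_closed _ _ [pred u | if unlift ord0 u is Some v
      then v \in porbit q i else false]); rewrite !inE !liftK; apply.
    move=> u; rewrite !inE; case: (unliftP ord0 u) => [v ->|->].
      rewrite insert_perm_fix_lift !liftK => /porbit_trans; apply.
      exact: porbit_step.
    by [].
  exact: porbit_id.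
move=> /(@porbit_closed _ _ [pred u | lift ord0 u \in porbit p (lift ord0 i)]).
rewrite !inE; apply; last exact: porbit_id.
move=> u; rewrite !inE => /porbit_trans; apply.
by rewrite -insert_perm_fix_lift porbit_step.
Qed.

Lemma card_porbit_insert_fix n (q : 'S_n) i :
  #|porbit (insert_perm q ord0) (lift ord0 i)| = #|porbit q i|.
Proof.
rewrite -!sum1_card big_mkcond [in RHS]big_mkcond /= big_ord_recl /=.
rewrite porbit_sym porbit_insert_fix0. rewrite finset.in_set1 eq_sym (negPf (neq_lift _ _)).
  by rewrite add0n; apply: eq_bigr => k _; rewrite mem_porbit_insert_fix.
Qed.

(** Each cycle of length [m] is counted once by each of its [m] points. This reduces cycle counts to
    sums over points, whose cycle lengths are easy to follow under insertion. *)
Lemma sum_porbit_card n (p : 'S_n) m :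
  (\sum_(i < n) (#|porbit p i| == m) = m * ncycles p m)%N.
Proof.
have -> : (\sum_(i < n) (#|porbit p i| == m) =
  \sum_(i in [set: 'I_n]%SET) (#|porbit p i| == m))%N.
  by apply: eq_bigl => i; rewrite inE.
rewrite (partition_big_imset (porbit p)) /=.
have -> : porbit p @: [set: 'I_n]%SET = porbits p.
  by rewrite /porbits; apply/setP => c; apply/imsetP/imsetP => -[i _ ->];
    exists i.
rewrite /ncycles -sum1_card big_distrr /=.
rewrite [RHS](eq_bigl (fun c => (c \in porbits p) && (#|c| == m))); last first.
  by move=> c; rewrite inE.
rewrite [RHS]big_mkcondr /=; apply: eq_bigr => c /imsetP[i0 _ ->].
rewrite (eq_bigl (mem (porbit p i0))); last first.
  by move=> i; rewrite inE eq_porbit_mem /= ?inE.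
rewrite (eq_bigr (fun=> nat_of_bool (#|porbit p i0| == m))); last first.
  by move=> i /=; rewrite -eq_porbit_mem => /eqP ->.
by rewrite sum_nat_const; case: eqP => [->|_]; rewrite ?muln1 ?muln0.
Qed.

Lemma ncycles0 n (p : 'S_n) : ncycles p 0 = 0%N.
Proof.
apply/eqP; rewrite cards_eq0; apply/eqP/setP => c; rewrite !inE.
by apply/negP => /andP[/imsetP[i _ ->]]; rewrite (negPf (card_porbit_neq0 _ _)).
Qed.

Lemma ncycles_large n (p : 'S_n) m : (n < m)%N -> ncycles p m = 0%N.
Proof.
move=> nm; apply/eqP; rewrite cards_eq0; apply/eqP/setP => c; rewrite !inE.
apply/negP => /andP[_ /eqP cm].
by have := max_card c; rewrite cm card_ord leqNgt nm.
Qed.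

Lemma ncycles_insert_fix n (q : 'S_n) :
  ncycles (insert_perm q ord0) = incr_at 1 (ncycles q).
Proof.
apply/funext => -[|m]; first by rewrite /incr_at !ncycles0.
apply/eqP; rewrite -(eqn_pmul2l (ltn0Sn m)) -sum_porbit_card big_ord_recl.
rewrite porbit_insert_fix0 cards1 /incr_at mulnDr -sum_porbit_card.
under eq_bigr do rewrite card_porbit_insert_fix.
by rewrite addnC eqn_add2l [1%N == _]eq_sym; case: m => [|m] /=; rewrite ?muln1 ?muln0.
Qed.

(** The cycle of length [k] through [j] grows to length [k.+1] and no other changes. Adding a cycle
    on both sides expresses this replacement without subtraction. *)
Lemma ncycles_insert n (q : 'S_n) j (k := #|porbit q j|) :
  incr_at k (ncycles (insert_perm q (lift ord0 j))) =
  incr_at k.+1 (ncycles q).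
Proof.
apply/funext => -[|m]; 
  first by rewrite /incr_at !ncycles0 [0%N == k]eq_sym (negPf (card_porbit_neq0 _ _)).
apply/eqP; rewrite -(eqn_pmul2l (ltn0Sn m)) /incr_at !mulnDr.
rewrite -!sum_porbit_card big_ord_recl card_porbit_insert collapse0 porbit_id.
rewrite -/k addn1.
(* Among the old points, only the [k] points on the cycle of [j] change their cycle length. The new
   point, split off above, accounts for the missing unit in the factor [m]. *)
have h : (\sum_(i < n) (#|porbit (insert_perm q (lift ord0 j)) (lift ord0 i)| == m.+1)
   + m.+1 * (m.+1 == k) = \sum_(i < n) (#|porbit q i| == m.+1) + m * (m == k))%N.
  have split_sum (F : 'I_n -> nat) : (\sum_(i < n) F i =
      \sum_(i in porbit q j) F i + \sum_(i | i \notin porbit q j) F i)%N.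
    exact: bigID.
  rewrite !split_sum.
  rewrite (eq_bigr (fun=> nat_of_bool (k == m))); last first.
    move=> i ij; rewrite card_porbit_insert collapse_lift porbit_sym ij addn1 eqSS.
    by move: ij; rewrite -eq_porbit_mem => /eqP ->.
  rewrite [X in (_ + X + _)%N](eq_bigr (fun i => nat_of_bool (#|porbit q i| == m.+1)));
    last first.
    move=> i ij; rewrite card_porbit_insert collapse_lift.
    by rewrite porbit_sym (negPf ij) addn0.
  rewrite [in RHS](eq_bigr (fun=> nat_of_bool (k == m.+1))); last first.
    by move=> i; rewrite -eq_porbit_mem => /eqP ->.
  rewrite !sum_nat_const -/k ![_ == k]eq_sym.
  case: (eqVneq k m) => [->|_]; first by rewrite ltn_eqF //=; lia.
  by case: (eqVneq k m.+1) => [->|_] //=; lia.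
have -> : (k.+1 == m.+1) = (m == k) by rewrite eqSS eq_sym.
rewrite eqSS -addnA h.
by apply/eqP; nia.
Qed.

(** The choice [k] can be read off as the point sent to [ord0], and then [q] is determined; by (n +
    1)! = (n + 1) n!, injectivity is enough. *)
Lemma insert_perm_bij n :
  bijective (fun u : 'S_n * 'I_n.+1 => insert_perm u.1 u.2).
Proof.
apply: inj_card_bij; last first.
  by rewrite card_prod !card_Sn card_ord factS mulnC.
move=> [q k] [q' k'] /= e.
have ek : k = k'.
  apply: (@perm_inj _ (insert_perm q k)).
  by rewrite {2}e !permM !tpermR !lift_perm_id.
move: e; rewrite -ek => /mulgI e; congr pair; apply/permP => i.
by apply: (@lift_inj _ ord0); rewrite -!(lift_perm_lift ord0) e.
Qed.

(** * Means over uniform permutations *)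

(** Truncated subtraction does no harm, since it acts on positive entries or beside a factor that
    vanishes where the entry is zero. *)
Definition decr_at (k : nat) (c : nat -> nat) : nat -> nat :=
  fun m => (c m - (m == k))%N.

Lemma incr_atK k : cancel (incr_at k) (decr_at k).
Proof. by move=> c; apply/funext => m; rewrite /decr_at /incr_at addnK. Qed.

Lemma incr_atC k l c : incr_at k (incr_at l c) = incr_at l (incr_at k c).
Proof. by apply/funext => m; rewrite /incr_at addnAC. Qed.

Definition perm_mean (R : realType) (n : nat) (g : (nat -> nat) -> R) : R :=
  (n`!%:R)^-1 * \sum_(p : 'S_n) g (ncycles p).

Section perm_mean_theory.
Variable R : realType.
Implicit Types (g h : (nat -> nat) -> R) (n m : nat).
Local Notation E := (@perm_mean R).

Lemma factr_neq0 n : n`!%:R != 0 :> R.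
Proof. by rewrite pnatr_eq0 -lt0n fact_gt0. Qed.

Lemma eq_perm_mean n g h : (forall p : 'S_n, g (ncycles p) = h (ncycles p)) ->
  E n g = E n h.
Proof. by move=> gh; congr (_ * _); apply: eq_bigr => p _; rewrite gh. Qed.

Lemma perm_mean_cst n (a : R) : E n (fun=> a) = a.
Proof.
rewrite /perm_mean sumr_const card_Sn -[a *+ _]mulr_natl.
by rewrite mulKf ?factr_neq0.
Qed.

Lemma perm_meanD n g h : E n (fun c => g c + h c) = E n g + E n h.
Proof. by rewrite /perm_mean big_split mulrDr. Qed.

Lemma perm_meanZ n a g : E n (fun c => a * g c) = a * E n g.
Proof. by rewrite /perm_mean -mulr_sumr mulrCA. Qed.

Lemma perm_mean_sum (I : Type) (r : seq I) (Q : pred I) n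
    (F : I -> (nat -> nat) -> R) :
  E n (fun c => \sum_(i <- r | Q i) F i c) = \sum_(i <- r | Q i) E n (F i).
Proof. by rewrite /perm_mean exchange_big mulr_sumr. Qed.

Lemma ler_perm_mean n g h : (forall p : 'S_n, g (ncycles p) <= h (ncycles p)) ->
  E n g <= E n h.
Proof.
by move=> gh; rewrite ler_wpM2l ?invr_ge0 ?ler0n// ler_sum.
Qed.

Lemma ler_norm_perm_mean n g : `|E n g| <= E n (fun c => `|g c|).
Proof.
rewrite normrM ger0_norm ?invr_ge0 ?ler0n//.
by rewrite ler_wpM2l ?invr_ge0 ?ler0n// ler_norm_sum.
Qed.

Lemma sum_porbit_weight n (q : 'S_n) (G : nat -> R) :
  \sum_(j < n) G #|porbit q j| =
  \sum_(m < n.+1) m%:R * ((ncycles q m)%:R * G m).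
Proof.
under [RHS]eq_bigr do rewrite mulrA -natrM -sum_porbit_card natr_sum mulr_suml.
rewrite exchange_big /=; apply: eq_bigr => j _.
have jn : (#|porbit q j| < n.+1)%N.
  by rewrite ltnS (leq_trans (max_card _)) ?card_ord.
rewrite (bigD1 (Ordinal jn)) //= eqxx mul1r big1 ?addr0 // => m mj.
rewrite eq_sym (_ : (_ == _) = false) ?mul0r //.
by apply: contraNF mj => /eqP e; apply/eqP/val_inj.
Qed.

(* The Chinese restaurant process: a uniform permutation of n + 1 points
   arises by inserting a new point into a uniform permutation of n points. *)
Lemma perm_mean_insert n g : n.+1%:R * E n.+1 g =
  E n (g \o incr_at 1) + \sum_(m < n.+1) m%:R *
    E n (fun c => (c m)%:R * g (decr_at m (incr_at m.+1 c))).
Proof.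
have [f' fK f'K] := insert_perm_bij n.
rewrite {1}/perm_mean factS natrM invfM mulrA mulVKf ?pnatr_eq0 //.
rewrite (reindex (fun u : 'S_n * 'I_n.+1 => insert_perm u.1 u.2)); last first.
  by exists f' => u _; [exact: fK | exact: f'K].
rewrite -(pair_bigA _ (fun q k => g (ncycles (insert_perm q k)))) /=.
rewrite (eq_bigr (fun q : 'S_n => g (incr_at 1 (ncycles q)) +
  \sum_(m < n.+1) m%:R * ((ncycles q m)%:R *
     g (decr_at m (incr_at m.+1 (ncycles q)))))); last first.
  move=> q _; rewrite big_ord_recl ncycles_insert_fix; congr (_ + _).
  rewrite -(sum_porbit_weight q (fun m => g (decr_at m (incr_at m.+1 _)))).
  by apply: eq_bigr => j _; rewrite -ncycles_insert incr_atK.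
rewrite big_split mulrDr; congr (_ + _).
rewrite exchange_big mulr_sumr; apply: eq_bigr => m _.
by rewrite -mulr_sumr mulrCA.
Qed.

Definition cycle_recursion n := forall g,
  n.+1%:R * E n.+1 g = \sum_(k < n.+1) E (n - k) (g \o incr_at k.+1).

Definition palm_formula n := forall m g,
  m.+1%:R * E n (fun c => (c m.+1)%:R * g c) =
  if (m < n)%N then E (n - m.+1) (g \o incr_at m.+1) else 0.

(** In the insertion formula, cycles of length m contribute m E_n[C_m g(C - e_m + e_{m+1})]; the
    Palm formula adds e_m back, which leaves E_{n-m}[g(C + e_{m+1})]. *)
Lemma palm_recursion n : palm_formula n -> cycle_recursion n.
Proof.
move=> palm g; rewrite perm_mean_insert big_ord_recl mul0r add0r.
rewrite big_ord_recl subn0; congr (_ + _); apply: eq_bigr => k _.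
rewrite palm ltn_ord; apply: eq_perm_mean => p.
by rewrite /= incr_atC incr_atK.
Qed.

Lemma palm0 : palm_formula 0.
Proof.
move=> m g /=; rewrite (@eq_perm_mean _ _ (fun=> 0)) ?perm_mean_cst ?mulr0 //.
by move=> p; rewrite ncycles_large // mul0r.
Qed.

(** With the recursion applied to C_{m+1} g, the term k = m contributes (m + 1)
    E_{n-m}[g(C + e_{m+1})] beyond the Palm terms. The recursion at a smaller size resums these into
    n - m copies of the same mean, giving n + 1 in all. *)
Lemma recursion_palm n : (forall k, (k <= n)%N -> palm_formula k) ->
  palm_formula n.+1.
Proof.
move=> palm m g.
have rec k : (k <= n)%N -> cycle_recursion k by move/palm/palm_recursion.
apply: (@mulfI _ n.+1%:R); first by rewrite pnatr_eq0.
rewrite mulrCA (rec n (leqnn n)) mulr_sumr.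
rewrite (eq_bigr (fun k : 'I_n.+1 =>
  (if (m < n - k)%N then
     E (n - k - m.+1) ((g \o incr_at m.+1) \o incr_at k.+1) else 0) +
  (if k == m :> nat then m.+1%:R * E (n - k) (g \o incr_at m.+1) else 0)));
  last first.
  move=> k _; have -> : E (n - k) ((fun c => (c m.+1)%:R * g c) \o incr_at k.+1)
    = E (n - k) (fun c => (c m.+1)%:R * g (incr_at k.+1 c)) +
      (k == m :> nat)%:R * E (n - k) (g \o incr_at m.+1).
    rewrite -perm_meanZ -perm_meanD; apply: eq_perm_mean => p /=.
    rewrite {1}/incr_at natrD mulrDl eqSS eq_sym.
    by move: (ncycles p) => c; case: eqP => [->|_] //; rewrite !mul0r.
  rewrite mulrDr palm ?leq_subr //; congr (_ + _).
    by case: ifP => // _; apply: eq_perm_mean => p /=; rewrite incr_atC.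
  by case: eqP => _; rewrite ?mul1r // mul0r mulr0.
rewrite big_split -big_mkcond /= -[X in _ + X]big_mkcond /= ltnS subSS.
case: leqP => [mn|nm]; last first.
  rewrite !big_pred0 ?addr0 ?mulr0 // => k.
    by have := ltn_ord k; lia.
  by have := ltn_ord k; lia.
rewrite [X in _ + X](big_pred1 (Ordinal (mn : (m < n.+1)%N))) //.
have -> : n.+1%:R = (n - m)%:R + m.+1%:R :> R.
  by rewrite -natrD; congr (_%:R); lia.
rewrite mulrDl; congr (_ + _) => /=.
case: (ltngtP m n) mn => // [mn _|-> _]; last first.
  by rewrite subnn mul0r big_pred0 // => k; lia.
have -> : (n - m = (n - m.+1).+1)%N by lia.
rewrite (rec _ (leq_subr _ _)).
have le1 : ((n - m.+1).+1 <= n.+1)%N by lia.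
rewrite (big_ord_widen _ (fun k => E (n - m.+1 - k)
  ((g \o incr_at m.+1) \o incr_at k.+1)) le1).
apply: eq_big => [k|k _]; first by lia.
by rewrite subnAC.
Qed.

Theorem perm_mean_palm n : palm_formula n.
Proof.
elim/ltn_ind: n => -[|n] IH; first exact: palm0.
by apply: recursion_palm => k kn; apply: IH.
Qed.

Theorem perm_mean_recursion n : cycle_recursion n.
Proof. exact/palm_recursion/perm_mean_palm. Qed.

Lemma perm_mean_ncycles_le n m : E n (fun c => (c m.+1)%:R) <= m.+1%:R^-1.
Proof.
rewrite -(@ler_pM2l _ m.+1%:R) ?ltr0n // mulfV ?pnatr_eq0 //.
rewrite (@eq_perm_mean _ _ (fun c => (c m.+1)%:R * 1)); last first.
  by move=> p; rewrite mulr1.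
by rewrite (perm_mean_palm _ _ (fun=> 1)); case: ifP; rewrite ?perm_mean_cst.
Qed.

End perm_mean_theory.

(** * Joint law of the short cycle counts *)

Lemma cvgn_geometric_increments (R : realType) (a : R^nat) (K q : R) :
  0 <= q < 1 -> (forall n, `|a n.+1 - a n| <= K * q ^+ n) -> cvgn a.
Proof.
move=> /andP[q0 q1] ha.
have : cvgn (series (telescope a)).
  apply: normed_cvg; apply: (@series_le_cvg _ _ (fun n => K * q ^+ n)).
  - by move=> n; exact: normr_ge0.
  - by move=> n; rewrite (le_trans _ (ha n)).
  - by move=> n; exact: ha.
  - by apply: is_cvg_geometric_series; rewrite ger0_norm.
move=> ct; rewrite (funext (eq_sum_telescope a)).
by apply: is_cvgD => //; exact: is_cvg_cst.
Qed.

(* The increments decay geometrically because each is [1/(n+1)] times a sum of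
   [M] earlier ones. *)
Lemma cvgn_delayed_average (R : realType) (a : R^nat) (M : nat) :
  (forall n, 0 <= a n <= 1) ->
  (forall n, (M < n)%N -> n.+1%:R * (a n.+1 - a n) = a (n - M)%N - a n) ->
  cvgn a.
Proof.
(* [N] is so large that [M * 2 ^ M <= n.+1] for [n >= N]. Below [N] the bound [2 ^+ N * 2^-1 ^+ n]
   exceeds 1 and is trivial; from [N] on, each of the [M] previous increments costs a factor of at
   most [2 ^ M], which the division by [n.+1] absorbs. *)
move=> a01 rec; pose N := (M * 2 ^ M + M).+1.
apply: (@cvgn_geometric_increments _ _ (2 ^+ N) 2^-1); first by lra.
elim/ltn_ind => n IH.
have [nN|Nn] := ltnP n N.
  have : `|a n.+1 - a n| <= 1.
    by rewrite ler_norml; have := a01 n; have := a01 n.+1; lra.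
  move/le_trans; apply; rewrite exprVn -[X in _ / X]mulr1 -(subnK (ltnW nN)) exprD.
  by rewrite mulr1 mulfK ?expf_neq0 // exprn_ege1 // ler1n.
have Mn : (M < n)%N by apply: leq_trans Nn; rewrite /N; lia.
have telM m : (m <= n)%N -> `|a (n - m)%N - a n| <=
    \sum_(j < m) `|a (n - j)%N - a (n - j.+1)%N|.
  elim: m => [_|m IHm mn]; first by rewrite subn0 subrr normr0 big_ord0.
  rewrite big_ord_recr /=; apply: le_trans (lerD (IHm (ltnW mn)) (lexx _)).
  rewrite [X in _ <= _ + X]distrC [X in _ <= X]addrC; apply: le_trans (ler_normD _ _).
  by rewrite addrA subrK.
have : n.+1%:R * `|a n.+1 - a n| <= n.+1%:R * (2 ^+ N * 2^-1 ^+ n).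
  rewrite -{1}(ger0_norm (ler0n R n.+1)) -normrM rec //.
  apply: le_trans (telM _ (ltnW Mn)) _.
  apply: (@le_trans _ _ (\sum_(j < M) (2 ^+ M * (2 ^+ N * 2^-1 ^+ n)))).
    apply: ler_sum => j _.
    have jM := ltn_ord j.
    have e : (n - j = (n - j.+1).+1)%N by lia.
    rewrite [X in a X]e; apply: (le_trans (IH _ _)); first by lia.
    rewrite mulrCA ler_wpM2l ?exprn_ge0 //.
    have -> : 2 ^+ M * 2^-1 ^+ n = 2^-1 ^+ (n - M) :> R.
      by rewrite -{1}(subnK (ltnW Mn)) exprD mulrCA -exprMn mulfV // expr1n mulr1.
    by apply: ler_wiXn2l; [lra|lra|lia].
  rewrite sumr_const card_ord -[X in X <= _]mulr_natl mulrA ler_wpM2r //.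
  by rewrite -natrX -natrM ler_nat; move: Nn; rewrite /N; lia.
by rewrite ler_pM2l // ltr0n.
Qed.

Definition same_upto (M : nat) (c c' : nat -> nat) : bool :=
  [forall i : 'I_M, c i.+1 == c' i.+1].

(** For cycle counts, the number of points on cycles of length at most [M]. *)
Definition weight_upto (M : nat) (c : nat -> nat) : nat :=
  (\sum_(i < M) i.+1 * c i.+1)%N.

Section cycle_counts_law.
Variables (R : realType) (M : nat).
Implicit Types (c : nat -> nat) (n : nat).
Local Notation E := (@perm_mean R).

(** The product of the Poisson weights with means 1/i, stripped of their exponential factors. *)
Definition cycle_type_density c : R :=
  \prod_(i < M) (i.+1%:R ^+ c i.+1 * (c i.+1)`!%:R)^-1.

Definition no_short_cycle n : R :=
  E n (fun c => (same_upto M c (fun=> 0%N))%:R).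

Lemma same_upto_incr i c c' :
  same_upto M (incr_at i c) (incr_at i c') = same_upto M c c'.
Proof. by apply: eq_forallb => j; rewrite /incr_at eqn_add2r. Qed.

Lemma weight_upto_incr i c : (i < M)%N ->
  weight_upto M (incr_at i.+1 c) = (weight_upto M c + i.+1)%N.
Proof.
move=> iM; rewrite /weight_upto [LHS](bigD1 (Ordinal iM)) //=.
rewrite [in RHS](bigD1 (Ordinal iM)) //= {1}/incr_at eqxx addn1 mulnSr.
rewrite -addnA [(i.+1 + _)%N]addnC addnA; congr (_ + _ + _)%N.
apply: eq_bigr => j ji; rewrite /incr_at eqSS (_ : (_ == _) = false) ?addn0 //.
by apply: contraNF ji => /eqP e; apply/eqP/val_inj.
Qed.

Lemma cycle_type_density_incr i c : (i < M)%N ->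
  cycle_type_density (incr_at i.+1 c) =
  (i.+1%:R * (c i.+1).+1%:R)^-1 * cycle_type_density c.
Proof.
move=> iM; rewrite /cycle_type_density [LHS](bigD1 (Ordinal iM)) //=.
rewrite [in RHS](bigD1 (Ordinal iM)) //= {1 2}/incr_at eqxx addn1.
rewrite mulrA -invfM factS natrM exprS; congr (_^-1 * _); first by ring.
apply: eq_bigr => j ji; rewrite /incr_at eqSS (_ : (_ == _) = false) ?addn0 //.
by apply: contraNF ji => /eqP e; apply/eqP/val_inj.
Qed.

(** Induction on the weight: the Palm formula removes one cycle of length [i.+1] together with its
    points, until no short cycle is prescribed. *)
Lemma perm_mean_same_upto n c :
  E n (fun c' => (same_upto M c' c)%:R) = cycle_type_density c *
    (if (weight_upto M c <= n)%N then no_short_cycle (n - weight_upto M c)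
     else 0).
Proof.
have [k] := ubnP (weight_upto M c); elim: k => // k IH in n c *.
rewrite ltnS => ck.
have [c0|/existsP[i ci]] := boolP [forall i : 'I_M, c i.+1 == 0%N].
  have w0 : weight_upto M c = 0%N.
    by apply: big1 => i _; rewrite (eqP (forallP c0 i)) muln0.
  rewrite w0 subn0 leq0n /cycle_type_density big1 ?mul1r; last first.
    by move=> i _; rewrite (eqP (forallP c0 i)) expr0 mul1r invr1.
  apply: eq_perm_mean => p; congr (_%:R); congr nat_of_bool.
  by apply: eq_forallb => i; rewrite (eqP (forallP c0 i)).
have iM := ltn_ord i.
have ec : c = incr_at i.+1 (decr_at i.+1 c).
  apply/funext => m; rewrite /incr_at /decr_at subnK //.
  by case: eqP => // ->; rewrite lt0n.
move: ck; rewrite ec; move: (decr_at _ _) => c' {ec ci}.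
rewrite weight_upto_incr // cycle_type_density_incr // => ck.
have pal := perm_mean_palm n i (fun b => (same_upto M b (incr_at i.+1 c'))%:R : R).
(* On this event the factor [b i.+1] is the constant [(c' i.+1).+1], so it can leave the mean. *)
rewrite (@eq_perm_mean _ _ _ (fun b => (c' i.+1).+1%:R *
  (same_upto M b (incr_at i.+1 c'))%:R)) in pal; last first.
  move=> p; case: (boolP (same_upto _ _ _)) => [/forallP/(_ i)/eqP ->|_].
    by rewrite /incr_at eqxx addn1.
  by rewrite !mulr0.
rewrite perm_meanZ mulrA in pal.
apply: (@mulfI _ (i.+1%:R * (c' i.+1).+1%:R)); first by rewrite mulf_neq0 ?pnatr_eq0.
rewrite pal !mulrA mulfV ?mul1r ?mulf_neq0 ?pnatr_eq0 //.
case: ltnP => [lt_in|le_ni].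
  rewrite (@eq_perm_mean _ _ _ (fun b => (same_upto M b c')%:R)); last first.
    by move=> p /=; rewrite same_upto_incr.
  rewrite IH; last by lia.
  have -> : (weight_upto M c' + i.+1 <= n)%N = (weight_upto M c' <= n - i.+1)%N.
    by lia.
  by case: ifP => // _; congr (_ * no_short_cycle _); lia.
by case: ifP => [|_]; [lia|rewrite mulr0].
Qed.

Lemma no_short_cycle_ge0_le1 n : 0 <= no_short_cycle n <= 1.
Proof.
apply/andP; split; first by rewrite mulr_ge0 ?invr_ge0 ?ler0n // sumr_ge0.
rewrite -[leRHS](perm_mean_cst n); apply: ler_perm_mean => p.
by rewrite lern1 leq_b1.
Qed.

(** In the cycle recursion only cycles of length above [M] may be added, that is, [M <= k] for the
    length [k.+1]. *)
Lemma no_short_cycle_sum n :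
  n.+1%:R * no_short_cycle n.+1 = \sum_(j < n.+1 - M) no_short_cycle j.
Proof.
rewrite perm_mean_recursion (eq_bigr (fun k : 'I_n.+1 =>
  if (M <= k)%N then no_short_cycle (n - k) else 0)); last first.
  move=> k _; case: leqP => kM.
    apply: eq_perm_mean => p /=; congr (_%:R); congr nat_of_bool.
    apply: eq_forallb => i; rewrite /incr_at eqSS.
    rewrite (_ : (i == k :> nat) = false) ?addn0 //.
    by have := ltn_ord i; lia.
  rewrite -[RHS](perm_mean_cst (n - k)); apply: eq_perm_mean => p /=.
  case: (boolP (same_upto _ _ _)) => // /forallP/(_ (Ordinal kM))/eqP.
  by rewrite /incr_at /= eqxx addn1.
rewrite -big_mkcond (reindex_inj rev_ord_inj) /=.
rewrite (big_ord_widen n.+1) ?leq_subr //.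
by apply: eq_big => [k|k _]; [|congr no_short_cycle]; have := ltn_ord k; lia.
Qed.

(** Subtracting two consecutive instances of the sum formula gives the recurrence of a delayed
    average. *)
Lemma cvgn_no_short_cycle : cvgn no_short_cycle.
Proof.
apply: (@cvgn_delayed_average _ _ M no_short_cycle_ge0_le1) => -[//|n] Mn.
rewrite mulrBr no_short_cycle_sum.
have -> : (n.+2 - M = (n.+1 - M).+1)%N by lia.
rewrite big_ord_recr /= -no_short_cycle_sum.
have -> : n.+2%:R = n.+1%:R + 1 :> R by rewrite -natr1.
by ring.
Qed.

End cycle_counts_law.

(** * The complex plane *)

Section complex_topology.
Variable R : realType.
Implicit Types (z w : R[i]).
Local Notation normc := Normc.normc.

Lemma normcE z : normc z = Num.sqrt (complex.Re z ^+ 2 + complex.Im z ^+ 2).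
Proof. by case: z. Qed.

Lemma normc_ge0 z : 0 <= normc z.
Proof. by rewrite normcE sqrtr_ge0. Qed.

Lemma ler_abs_Re z : `|complex.Re z| <= normc z.
Proof. by rewrite normcE -sqrtr_sqr ler_sqrt ?lerDl ?addr_ge0 ?sqr_ge0. Qed.

Lemma ler_abs_Im z : `|complex.Im z| <= normc z.
Proof. by rewrite normcE -sqrtr_sqr ler_sqrt ?lerDr ?addr_ge0 ?sqr_ge0. Qed.

Lemma normc_le_abs z : normc z <= `|complex.Re z| + `|complex.Im z|.
Proof.
rewrite normcE -(@ger0_norm _ (`|_| + `|_|)) ?addr_ge0 // -sqrtr_sqr.
rewrite ler_sqrt ?sqr_ge0 // sqrrD !real_normK ?num_real //.
by rewrite addrAC lerDl mulrn_wge0 // mulr_ge0.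
Qed.

Lemma normc_natr n : normc (n%:R : R[i]) = n%:R.
Proof.
have -> : n%:R = (n%:R : R)%:C :> R[i] by rewrite rmorph_nat.
by rewrite normcE /= expr0n addr0 sqrtr_sqr normr_nat.
Qed.

Lemma normcX z n : normc (z ^+ n) = normc z ^+ n.
Proof.
elim: n => [|n IH]; first by rewrite !expr0 Normc.normc1.
by rewrite !exprS Normc.normcM IH.
Qed.

Lemma normc_sum_le (I : Type) (r : seq I) (Q : pred I) (F : I -> R[i]) :
  normc (\sum_(i <- r | Q i) F i) <= \sum_(i <- r | Q i) normc (F i).
Proof.
elim/big_rec2: _ => [|i a b _ ab]; first by rewrite Normc.normc0.
by rewrite (le_trans (le_normcD _ _)) // lerD2l.
Qed.

Lemma complex_normr z : `|z| = (normc z)%:C.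
Proof. by rewrite normcE normc_def. Qed.

(** A positive element of [R[i]] is a positive real, so the modulus and a real [e] suffice to test
    convergence. *)
Lemma cvg_normcP (T : Type) (F : set_system T) {FF : Filter F}
    (g : T -> R[i]^o) (l : R[i]^o) :
  g x @[x --> F] --> l <->
  forall e : R, 0 < e -> \forall t \near F, normc (l - g t) < e.
Proof.
split=> [/cvgrPdist_lt gl e e0|gl].
  have e0C : 0 < (e%:C : R[i]) by rewrite ltcE /= eqxx.
  apply: filterS (gl _ e0C) => t.
  by rewrite complex_normr ltcR.
apply/cvgrPdist_lt => e; rewrite ltcE => /andP[/eqP e_im e0].
apply: filterS (gl _ e0) => t.
by rewrite complex_normr ltcE /= e_im eqxx.
Qed.

Lemma near_normc z (e : R) : 0 < e ->
  \forall w \near (z : R[i]^o), normc (z - w) < e.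
Proof.
by move=> e0; apply: (@cvg_normcP _ (nbhs (z : R[i]^o)) _ id z).1 e0; exact: cvg_id.
Qed.

Lemma continuous_Re : continuous (@complex.Re R : R[i]^o -> R).
Proof.
move=> z; apply/(@cvgrPdist_lt _ _ _ _ (nbhs_filter (z : R[i]^o))) => e e0.
have := near_normc z e0.
apply: filterS => w; apply: le_lt_trans.
by have := ler_abs_Re (z - w); case: z w => ? ? [? ?].
Qed.

Lemma continuous_Im : continuous (@complex.Im R : R[i]^o -> R).
Proof.
move=> z; apply/(@cvgrPdist_lt _ _ _ _ (nbhs_filter (z : R[i]^o))) => e e0.
have := near_normc z e0.
apply: filterS => w; apply: le_lt_trans.
by have := ler_abs_Im (z - w); case: z w => ? ? [? ?].
Qed.

Lemma cvg_Complex (T : Type) (F : set_system T) {FF : Filter F}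
    (f g : T -> R) (a b : R) :
  f x @[x --> F] --> a -> g x @[x --> F] --> b ->
  (f x +i* g x : R[i]^o) @[x --> F] --> (a +i* b : R[i]^o).
Proof.
move=> /cvgrPdist_lt fa /cvgrPdist_lt gb; apply/cvg_normcP => e e0.
have e20 : 0 < e / 2 by rewrite divr_gt0.
apply: filterS2 (fa _ e20) (gb _ e20) => t h1 h2.
rewrite (le_lt_trans (normc_le_abs _)) //=.
by rewrite (splitr e) ltrD.
Qed.

Lemma cexpD z w : cexp (z + w) = cexp z * cexp w.
Proof.
case: z w => [a b] [a' b']; rewrite /cexp /= expRD cosD sinD.
rewrite rmorphM /= mulrACA; congr (_ * _).
by apply/eqP; rewrite eq_complex /=; apply/andP; split; apply/eqP; ring.
Qed.

Lemma cexp0 : cexp (0 : R[i]) = 1.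
Proof. by rewrite /cexp /= expR0 cos0 sin0 mul1r. Qed.

Lemma cexp_sum (I : Type) (r : seq I) (Q : pred I) (F : I -> R[i]) :
  cexp (\sum_(i <- r | Q i) F i) = \prod_(i <- r | Q i) cexp (F i).
Proof. by apply: (big_morph _ cexpD cexp0). Qed.

Lemma continuous_cexp : continuous (@cexp R : R[i]^o -> R[i]^o).
Proof.
move=> z.
have eE : (@cexp R) = fun w => (expR (complex.Re w) * cos (complex.Im w)) +i*
    (expR (complex.Re w) * sin (complex.Im w)).
  apply/funext => w; rewrite /cexp; apply/eqP; rewrite eq_complex /=.
  by rewrite !mul0r subr0 addr0 !eqxx.
rewrite /continuous_at eE.
have cR : expR (complex.Re (w : R[i]^o)) @[w --> z] --> expR (complex.Re z).
  exact: (cvg_comp _ _ (@continuous_Re z) (@continuous_expR R _)).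
apply: (@cvg_Complex _ (nbhs (z : R[i]^o)) _);
  apply: (@cvgM _ _ (nbhs (z : R[i]^o)) _) => //.
  exact: (cvg_comp _ _ (@continuous_Im z) (@continuous_cos R _)).
exact: (cvg_comp _ _ (@continuous_Im z) (@continuous_sin R _)).
Qed.

(** Stronger than uniform continuity on [K], as [y] may leave [K]; the near-covering form of
    compactness yields one radius for all [x]. *)
Lemma unif_continuous_near_compact (T : pseudoMetricType R) (K : set T)
    (f : T -> R) (e : R) : compact K -> continuous f -> 0 < e ->
  exists2 d : R, 0 < d &
    forall x y, K x -> ball x d y -> `|f x - f y| < e.
Proof.
move=> /compact_near_coveringP cK cf e0.
have := cK R (0^'+)%R (fun d x => forall y, ball x d y -> `|f x - f y| < e) _.
case.
  move=> x Kx.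
  have /cvgrPdist_lt/(_ (e / 2)) := cf x; rewrite divr_gt0 // => /(_ isT).
  rewrite near_nbhs => /nbhs_ballP[d /= d0 fd].
  exists (ball x (d / 2), [set r : R | 0 < r < d / 2]) => /=.
    split; first by apply: nbhsx_ballx; rewrite divr_gt0.
    near=> r; apply/andP; split; near: r; first exact: nbhs_right_gt.
    by apply: nbhs_right_lt; rewrite divr_gt0.
  move=> [y r] /= [xy /andP[r0 rd]] t yt.
  have xyd : ball x d y by apply: le_ball xy; lra.
  have xt : ball x d t.
    by rewrite (splitr d); apply: ball_triangle xy (le_ball _ yt); exact: ltW.
  rewrite (splitr e) -(subrK (f x) (f y)) -addrA.
  rewrite (le_lt_trans (ler_normD _ _)) // ltrD //; last exact: fd.
  by rewrite distrC; exact: fd.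
move=> d /= d0 Kd.
exists (d / 2); first by rewrite divr_gt0.
move=> x y Kx xy; apply: (Kd (d / 2)) => //=.
  by rewrite sub0r normrN gtr0_norm ?divr_gt0 // ltr_pdivrMr // ltr_pMr // ltr1n.
by rewrite divr_gt0.
Unshelve. all: by end_near. Qed.

(** The disc of radius [k] lies in a square that is compact in the product [R * R]; the map [mk]
    carries the estimate over. *)
Lemma unif_continuous_bounded_complex (f : R[i]^o -> R) (k e : R) :
  continuous f -> 0 < e ->
  exists2 d : R, 0 < d & forall z w, normc z <= k -> normc (z - w) < d ->
    `|f z - f w| < e.
Proof.
move=> cf e0.
pose mk (u : R * R) : R[i]^o := u.1 +i* u.2.
have cmk : continuous mk.
  by move=> u; apply: cvg_Complex; [exact: cvg_fst|exact: cvg_snd].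
have cfmk : continuous (f \o mk).
  by move=> u; apply: continuous_comp; [exact: cmk|exact: cf].
have cK : compact (`[- k, k]%classic `*` `[- k, k]%classic : set (R * R)).
  by apply: compact_setX; exact: segment_compact.
have [d d0 hd] := unif_continuous_near_compact cK cfmk e0.
exists d => // -[a b] [a' b'] zk zw.
apply: (hd (a, b) (a', b')) => /=.
  have := le_trans (ler_abs_Re _) zk; have := le_trans (ler_abs_Im _) zk.
  by rewrite /= !in_itv /= !ler_norml.
by split => /=; apply: le_lt_trans zw; 
  [exact: (ler_abs_Re ((a +i* b) - (a' +i* b')))|exact: (ler_abs_Im ((a +i* b) - (a' +i* b')))].
Qed.

End complex_topology.

(** * Logarithms and truncated sums *)

Section log_bound.
Variable R : realType.
Implicit Types (z w : R[i]).
Local Notation normc := Normc.normc.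

(** The difference sin u - u cos u has derivative u sin u, which is nonnegative on [0, pi]. This
    will bound the argument of a point in the right half-plane. *)
Lemma mul_cos_le_sin (t : R) : 0 <= t <= pi -> t * cos t <= sin t.
Proof.
move=> /andP[t0 tpi]; rewrite -subr_ge0.
pose g (u : R) := sin u - u * cos u.
have g' (u : R) : is_derive u 1 g (u * sin u).
  rewrite /g; apply: is_derive_eq.
  by rewrite /GRing.scale /=; ring.
have -> : 0 = g 0 by rewrite /g sin0 mul0r subr0.
apply: (@ger0_derive1_ndecr _ g 0 pi) => //.
- move=> u; rewrite in_itv /= => /andP[u0 upi].
  by rewrite derive1E (derive_val (is_derive := g' u)) mulr_ge0 ?ltW // sin_gt0_pi ?u0.
- by apply: continuous_subspaceT => u; apply: differentiable_continuous; exact/derivable1_diffP.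
Qed.

(** With w = 1 - z, the inequality ln(1 + u) <= u, applied to |w| and to 1/|w|, bounds the real
    part. The absolute argument t satisfies t Re w <= |Im w| <= |z| by [mul_cos_le_sin], and Re w >=
    1 - |z|. *)
Lemma normc_cLog1B z : normc z < 1 ->
  normc (cLog (1 - z)) <= 2 * (normc z / (1 - normc z)).
Proof.
set r := normc z => r1; have r0 : 0 <= r by exact: normc_ge0.
pose w := 1 - z; pose n := normc w.
have s0 : 0 < 1 - r by rewrite subr_gt0.
have Re_ge : 1 - r <= complex.Re w.
  have := le_trans (ler_norm _) (ler_abs_Re z).
  by rewrite /w -/r; case: (z) => a b /=; lra.
have n_ge : 1 - r <= n.
  by apply: le_trans Re_ge (le_trans (ler_norm _) (ler_abs_Re w)).
have n0 : 0 < n by apply: lt_le_trans n_ge.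
have n_le : n <= 1 + r.
  by rewrite (le_trans (le_normcD _ _)) // Normc.normc1 normcN.
have q_ge : r <= r / (1 - r).
  by rewrite ler_pdivlMr // ler_piMr //; lra.
rewrite (le_trans (normc_le_abs _)) // mulr_natl mulr2n lerD //.
  rewrite -/w /= -/n ler_norml; apply/andP; split.
    rewrite -[ln n]opprK -lnV ?posrE // lerN2.
    have -> : n^-1 = 1 + (n^-1 - 1) by rewrite addrC subrK.
    apply: le_trans (le_ln1Dx _) _; first by have := invr_gt0 n; rewrite n0; lra.
    have -> : r / (1 - r) = (1 - r)^-1 - 1 by field; rewrite gt_eqF.
    by rewrite lerB // lef_pV2.
  apply: le_trans q_ge; have -> : n = 1 + (n - 1) by rewrite addrC subrK.
  by apply: le_trans (le_ln1Dx _) _; lra.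
pose t := acos (complex.Re w / n).
have -> : `|complex.Im (cLog w)| = t.
  have c1 : -1 <= complex.Re w / n <= 1.
    rewrite -ler_norml normrM normfV (gtr0_norm n0) ler_pdivrMr // mul1r.
    exact: ler_abs_Re.
  rewrite /= /carg -/n -/t; case: ifP => _; rewrite ?normrN ger0_norm //;
    exact: acos_ge0.
have Re0 : 0 < complex.Re w by apply: lt_le_trans Re_ge.
have c1 : -1 <= complex.Re w / n <= 1.
  rewrite -ler_norml normrM normfV (gtr0_norm n0) ler_pdivrMr // mul1r.
  exact: ler_abs_Re.
have tpi : 0 <= t <= pi by rewrite acos_ge0 // acos_lepi.
have := mul_cos_le_sin tpi.
rewrite /t acosK ?in_itv //= sin_acos // -/t.
have -> : 1 - (complex.Re w / n) ^+ 2 = (complex.Im w / n) ^+ 2.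
  have n2 : n ^+ 2 = complex.Re w ^+ 2 + complex.Im w ^+ 2.
    by rewrite /n normcE sqr_sqrtr // addr_ge0 ?sqr_ge0.
  rewrite !expr_div_n; apply: (@mulIf _ (n ^+ 2)); first by rewrite expf_neq0 ?gt_eqF.
  by rewrite mulrBl !divfK ?expf_neq0 ?gt_eqF // mul1r {1}n2 addrC addKr.
rewrite sqrtr_sqr normrM normfV (gtr0_norm n0) mulrA ler_pM2r ?invr_gt0 // => h.
rewrite ler_pdivlMr //; apply: le_trans (_ : t * complex.Re w <= r).
  by rewrite ler_wpM2l //; case/andP: tpi.
apply: le_trans h _; apply: le_trans (ler_abs_Im z).
by rewrite /w; case: (z) => a b /=; rewrite sub0r normrN.
Qed.

End log_bound.

Section truncation.
Variable R : realType.
Variable L : nat -> R[i].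
Local Notation normc := Normc.normc.
Local Notation E := (@perm_mean R).

Definition cycle_sum (n : nat) (c : nat -> nat) : R[i]^o :=
  \sum_(i < n) (c i.+1)%:R * L i.

Lemma cycle_sum_ncycles n k (p : 'S_n) :
  cycle_sum (n + k) (ncycles p) = cycle_sum n (ncycles p).
Proof.
rewrite /cycle_sum big_split_ord /= [X in _ + X]big1 ?addr0 // => i _.
by rewrite ncycles_large ?mul0r //= ltnS leq_addr.
Qed.

Lemma normc_cycle_sumB n k c :
  normc (cycle_sum n c - cycle_sum (n + k) c) <=
  \sum_(i < k) (c (n + i).+1)%:R * normc (L (n + i)%N).
Proof.
rewrite /cycle_sum big_split_ord /= opprD addNKr normcN.
rewrite (le_trans (normc_sum_le _ _ _)) // ler_sum // => i _.
by rewrite Normc.normcM normc_natr.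
Qed.

Lemma normc_cycle_sum_le n c :
  normc (cycle_sum n c) <= \sum_(i < n) (c i.+1)%:R * normc (L i).
Proof.
rewrite (le_trans (normc_sum_le _ _ _)) // ler_sum // => i _.
by rewrite Normc.normcM normc_natr.
Qed.

Lemma perm_mean_weighted_le n k l (b : nat -> R) : (forall i, 0 <= b i) ->
  E n (fun c => \sum_(i < k) (c (l + i).+1)%:R * b (l + i)%N) <=
  \sum_(i < k) b (l + i)%N.
Proof.
move=> b0; rewrite perm_mean_sum ler_sum // => i _.
rewrite (@eq_perm_mean _ _ _ (fun c => b (l + i)%N * (c (l + i).+1)%:R)); last first.
  by move=> p; rewrite mulrC.
rewrite perm_meanZ ler_piMr // (le_trans (perm_mean_ncycles_le _ _ _)) //.
by rewrite invf_le1 ?ltr0n // ler1n.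
Qed.

(** The test function changes little unless the truncated sum is large or the tail is not small.
    Markov's inequality controls both events, with first moments bounded uniformly in [n] by
    [perm_mean_weighted_le]. *)
Lemma truncation_error (f : R[i]^o -> R) (B e : R) :
  cvgn (series (fun i => normc (L i))) ->
  continuous f -> (forall z, `|f z| <= B) -> 0 < e ->
  exists M0 : nat, forall M n, (M0 <= M)%N ->
    `|E n (f \o cycle_sum n) - E n (f \o cycle_sum M)| <= e.
Proof.
set b := fun i => normc (L i) => cvgb cf fB e0.
have b0 i : 0 <= b i by exact: normc_ge0.
pose B' := `|B| + 1; have B'0 : 0 < B' by rewrite ltr_wpDl.
have fB' z : `|f z| <= B' by have := fB z; have := ler_norm B; rewrite /B'; lra.
pose Lam := limn (series b).
have bLam n : \sum_(i < n) b i <= Lam.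
  have := @nondecreasing_cvgn_le _ (series b) _ cvgb n; rewrite /series /= big_mkord.
  by apply; apply/nondecreasing_series.
have Lam0 : 0 <= Lam by have := bLam 0%N; rewrite big_ord0.
(* [k] and, below, [t] are chosen so that the two Markov terms of [G] have mean at most [e / 3]
   each; the summand 1 keeps [k] positive when [Lam] is 0. *)
pose k := 6 * B' * Lam / e + 1.
have k0 : 0 < k by rewrite ltr_wpDl // divr_ge0 ?mulr_ge0 // ltW.
have e30 : 0 < e / 3 by rewrite divr_gt0.
have [d d0 hd] := unif_continuous_bounded_complex k cf e30.
pose t := d * e / (6 * B').
have t0 : 0 < t by rewrite divr_gt0 ?mulr_gt0.
have [M0 _ hM0] : \forall M \near \oo, Lam - series b M < t.
  have /cvgrPdist_lt/(_ t t0) := cvgb.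
  by apply: filterS => M; apply: le_lt_trans (ler_norm _).
exists M0 => M n M0M.
have tail j : \sum_(i < j) b (M + i)%N <= t.
  have := bLam (M + j)%N; rewrite big_split_ord /=.
  have := hM0 M M0M; rewrite /series /= big_mkord; lra.
(* No cycle is longer than [n], so [n] may be replaced by [M + n]; then [M] truncates the sum
   whether or not it exceeds [n]. *)
rewrite (@eq_perm_mean _ _ (f \o cycle_sum n) (f \o cycle_sum (M + n))); last first.
  by move=> p /=; rewrite addnC cycle_sum_ncycles.
(* Each weighted sum in [G], divided by [k] or [d], is at least 1 on the event it controls, where
   [2 * B'] bounds the difference. *)
pose G c := e / 3 + 2 * B' / k * (\sum_(i < M) (c i.+1)%:R * b i)
  + 2 * B' / d * (\sum_(i < n) (c (M + i).+1)%:R * b (M + i)%N).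
have fG c : `|f (cycle_sum (M + n) c) - f (cycle_sum M c)| <= G c.
  have s1 : 0 <= \sum_(i < M) (c i.+1)%:R * b i.
    by rewrite sumr_ge0 // => i _; rewrite mulr_ge0.
  have s2 : 0 <= \sum_(i < n) (c (M + i).+1)%:R * b (M + i)%N.
    by rewrite sumr_ge0 // => i _; rewrite mulr_ge0.
  have c1 : 0 <= 2 * B' / k by rewrite divr_ge0 ?mulr_ge0 // ltW.
  have c2 : 0 <= 2 * B' / d by rewrite divr_ge0 ?mulr_ge0 // ltW.
  have f2B : `|f (cycle_sum (M + n) c) - f (cycle_sum M c)| <= 2 * B'.
    apply: le_trans (ler_normB _ _) _.
    by have := fB' (cycle_sum (M + n) c); have := fB' (cycle_sum M c); lra.
  have [kS|Sk] := ltP k (normc (cycle_sum M c)).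
    have : 2 * B' <= 2 * B' / k * (\sum_(i < M) (c i.+1)%:R * b i).
      rewrite mulrAC ler_pdivlMr //; apply: ler_wpM2l; first by rewrite mulr_ge0 ?ltW.
      by apply: le_trans (ltW kS) _; exact: normc_cycle_sum_le.
    by have := mulr_ge0 c2 s2; rewrite /G; lra.
  have [Sd|dS] := ltP (normc (cycle_sum M c - cycle_sum (M + n) c)) d.
    have := hd _ _ Sk Sd; rewrite distrC => /ltW.
    by have := mulr_ge0 c2 s2; have := mulr_ge0 c1 s1; rewrite /G; lra.
  have : 2 * B' <= 2 * B' / d * (\sum_(i < n) (c (M + i).+1)%:R * b (M + i)%N).
    rewrite mulrAC ler_pdivlMr //; apply: ler_wpM2l; first by rewrite mulr_ge0 ?ltW.
    by apply: (le_trans dS); exact: normc_cycle_sumB.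
  by have := mulr_ge0 c1 s1; rewrite /G; lra.
have -> : E n (f \o cycle_sum (M + n)) - E n (f \o cycle_sum M) =
    E n (fun c => f (cycle_sum (M + n) c) - f (cycle_sum M c)).
  rewrite -mulN1r -perm_meanZ -perm_meanD; apply: eq_perm_mean => p /=.
  by rewrite mulN1r.
apply: le_trans (ler_norm_perm_mean _ _) _.
apply: (@le_trans _ _ (E n G)); first by apply: ler_perm_mean => p; exact: fG.
rewrite /G !perm_meanD !perm_meanZ perm_mean_cst.
have h1 : 2 * B' / k * E n (fun c => \sum_(i < M) (c i.+1)%:R * b i) <= e / 3.
  have : E n (fun c => \sum_(i < M) (c i.+1)%:R * b i) <= Lam.
    by apply: le_trans (bLam M); exact: (perm_mean_weighted_le n M 0 b0).
  move=> h; apply: (@le_trans _ _ (2 * B' / k * Lam)).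
    by rewrite ler_wpM2l // divr_ge0 ?mulr_ge0 // ltW.
  rewrite mulrAC ler_pdivrMr // /k.
  have -> : e / 3 * (6 * B' * Lam / e + 1) = 2 * B' * Lam + e / 3.
    by field; rewrite gt_eqF.
  by rewrite lerDl ltW.
have h2 : 2 * B' / d * E n (fun c => \sum_(i < n) (c (M + i).+1)%:R * b (M + i)%N)
    <= e / 3.
  apply: (@le_trans _ _ (2 * B' / d * t)).
    apply: ler_wpM2l; first by rewrite divr_ge0 ?mulr_ge0 ?ltW.
    exact: le_trans (perm_mean_weighted_le n n M b0) (tail n).
  rewrite /t le_eqVlt; apply/orP; left; apply/eqP.
  by field; rewrite !gt_eqF.
lra.
Qed.

End truncation.

(** * Integrals over sets of full measure *)

Section null_set.
Context d (T : measurableType d) (R : realType).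
Variables (mu : {measure set T -> \bar R}) (A : set T).
Hypotheses (mA : measurable A) (A0 : mu (~` A) = 0%E).
Local Open Scope ereal_scope.
Import HBNNSimple.

(** The integral of a nonnegative function is the supremum over the simple functions below it, and
    cutting a simple function down to [A] keeps its integral; the argument is valid for arbitrary
    [g]. *)
Let ge0_integral_conull (g : T -> \bar R) : (forall x, 0 <= g x) ->
  \int[mu]_x g x = \int[mu]_(x in A) g x.
Proof.
move=> g0; rewrite [RHS]integral_mkcond.
have gA0 x : 0 <= (g \_ A) x by rewrite patchE; case: ifP.
rewrite !ge0_integralTE //; apply/eqP; rewrite eq_le; apply/andP; split.
  apply: ge_ereal_sup => _ [h hg <-]; apply: ereal_sup_ubound.
  exists (proj_nnsfun h mA) => /=.
    move=> x; rewrite patchE /= mindicE; case: ifP => _; last by rewrite mulr0.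
    by rewrite mulr1.
  rewrite -!integralT_nnsfun (ge0_negligible_integral (measurableC mA)) //.
  - rewrite [RHS](ge0_negligible_integral (measurableC mA)) //.
    + apply: eq_integral => x; rewrite inE => -[_ /contrapT Ax] /=.
      by rewrite mindicE mem_set // mulr1.
    + exact/measurable_EFinP.
    + by move=> x _; rewrite lee_fin.
  - exact/measurable_EFinP.
  - by move=> x _; rewrite lee_fin.
apply: ereal_sup_le => _ [h hg <-]; exists h => //.
by move=> x; apply: le_trans (hg x) _; rewrite patchE; case: ifP.
Qed.

(* [g] need not be measurable: the limit variables of the theorem are [lim]s
   with a junk value on a null event. *)
Lemma integral_conull (g : T -> \bar R) :
  \int[mu]_x g x = \int[mu]_(x in A) g x.
Proof.
rewrite integralE [RHS]integralE.
by congr (_ - _); apply: ge0_integral_conull => x;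
  [exact: funepos_ge0|exact: funeneg_ge0].
Qed.

End null_set.

(** * Functions of finitely many counts *)

Section patterns.
Variable M : nat.

(** Extends a finite vector to a count function; the entry at 0 is a default that [same_upto]
    ignores. *)
Definition pattern (k : 'I_M -> nat) : nat -> nat :=
  fun m => if insub m.-1 is Some i then k i else 0%N.

Lemma patternE (k : 'I_M -> nat) (i : 'I_M) : pattern k i.+1 = k i.
Proof. by rewrite /pattern /= valK. Qed.

Definition depends_upto (X : Type) (F : (nat -> nat) -> X) :=
  forall c c', same_upto M c c' -> F c = F c'.

Lemma sum_patterns (R : realType) n (F : (nat -> nat) -> R) (c : nat -> nat) :
  depends_upto F -> (forall i : 'I_M, (c i.+1 <= n)%N) ->
  F c = \sum_(k : {ffun 'I_M -> 'I_n.+1})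
    F (pattern (fun i => k i)) * (same_upto M c (pattern (fun i => k i)))%:R.
Proof.
move=> Fdep cn; pose k0 : {ffun 'I_M -> 'I_n.+1} := [ffun i : 'I_M => inord (c i.+1)].
have k0P : same_upto M c (pattern (fun i => k0 i)).
  by apply/forallP => i; rewrite patternE ffunE inordK // ltnS.
rewrite (bigD1 k0) //= k0P mulr1 big1 ?addr0 => [|k kk0]; first exact: Fdep.
rewrite (_ : same_upto _ _ _ = false) ?mulr0 //.
apply: contraNF kk0 => /forallP ck; apply/eqP/ffunP => i.
by apply: val_inj; rewrite ffunE /= inordK ?ltnS // (eqP (ck i)) patternE.
Qed.

End patterns.

(** * Comparison with the Poisson variables *)

Section poisson_counts.
Context (R : realType) (d : measure_display) (T : measurableType d)
  (P : probability T R) (Y : nat -> {RV P >-> nat}).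
Hypothesis Y_indep : mutually_independent [set m : nat | (0 < m)%N] Y.
Hypothesis Y_poisson : forall m : nat, (0 < m)%N ->
  poisson_distributed (Y m) (m%:R^-1).
Local Notation E := (@perm_mean R).

Definition counts (w : T) : nat -> nat := fun m => Y m w.

Section fixed_level.
Variable M : nat.

Definition pattern_event (c : nat -> nat) : set T :=
  [set w | same_upto M (counts w) c].

Lemma measurable_preimage_nat m (A : set nat) : measurable (Y m @^-1` A).
Proof. by rewrite -[X in measurable X]setTI; exact: measurable_funPT. Qed.

Lemma pattern_eventE c : pattern_event c =
  \bigcap_(m in [set` [fset m in iota 1 M]%fset]) (Y m @^-1` [set c m]).
Proof.
apply/seteqP; split => [w /forallP wc m|w wc].
  rewrite /= !inE mem_iota add1n => /andP[m0 mM] /=.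
  have lt_mM : (m.-1 < M)%N by lia.
  by have /eqP := wc (Ordinal lt_mM); rewrite /= prednK.
apply/forallP => i; apply/eqP; apply: wc => /=.
by rewrite !inE mem_iota /= add1n ltnS ltn_ord.
Qed.

Lemma measurable_pattern_event c : measurable (pattern_event c).
Proof.
rewrite pattern_eventE; apply: fin_bigcap_measurable => // m _.
exact: measurable_preimage_nat.
Qed.

(** There are only countably many patterns, so every preimage is a countable union of pattern
    events. *)
Lemma measurable_depends_upto d' (X : measurableType d')
    (F : (nat -> nat) -> X) : depends_upto M F ->
  measurable_fun setT (F \o counts).
Proof.
move=> Fdep _ B mB; rewrite setTI.
have -> : (F \o counts) @^-1` B = \bigcup_(k : {ffun 'I_M -> nat})
    (if `[< B (F (pattern k)) >] then pattern_event (pattern k) else set0).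
  apply/seteqP; split => [w /= Bw|w [k _]].
    pose k := [ffun i : 'I_M => Y i.+1 w].
    have wk : same_upto M (counts w) (pattern k).
      by apply/forallP => i; rewrite patternE ffunE.
    by exists k => //; rewrite -(Fdep _ _ wk) asboolT.
  by case: ifP => // /asboolP Bk wk /=; rewrite (Fdep _ _ wk).
apply: countable_bigcupT_measurable; first exact: countableP.
move=> k; case: ifP => _; [exact: measurable_pattern_event|exact: measurable0].
Qed.

(** The probability that [Y 1], ..., [Y M] all vanish. *)
Definition poisson_zero_mass : R := \prod_(i < M) expR (- i.+1%:R^-1).

Lemma poisson_zero_mass_gt0 : 0 < poisson_zero_mass.
Proof. by apply: prodr_gt0 => i _; exact: expR_gt0. Qed.

Lemma probability_pattern_event c :
  P (pattern_event c) = (poisson_zero_mass * cycle_type_density R M c)%:E.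
Proof.
rewrite pattern_eventE Y_indep //; last first.
  by move=> m /=; rewrite !inE mem_iota => /andP[].
rewrite (perm_big (iota 1 M)) /=; last first.
  by apply: uniq_perm (fset_uniq _) (iota_uniq _ _) _ => m; rewrite !inE.
rewrite (_ : iota 1 M = index_iota 1 M.+1); last by rewrite /index_iota subn1.
rewrite big_add1 /= big_mkord -big_split /= -prodEFin.
apply: eq_bigr => i _; rewrite Y_poisson // /poisson_pmf invr_gt0 ltr0Sn.
by rewrite exprVn invfM mulrC.
Qed.

Definition tilt n (c : nat -> nat) : R := poisson_zero_mass^-1 *
  (if (weight_upto M c <= n)%N then no_short_cycle R M (n - weight_upto M c)
   else 0).

Lemma depends_upto_weight : depends_upto M (weight_upto M).
Proof.
by move=> c c' /forallP cc'; apply: eq_bigr => i _; rewrite (eqP (cc' i)).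
Qed.

Lemma depends_upto_tilt n : depends_upto M (tilt n).
Proof. by move=> c c' /depends_upto_weight e; rewrite /tilt e. Qed.

Lemma tilt_ge0 n c : 0 <= tilt n c.
Proof.
rewrite mulr_ge0 ?invr_ge0 ?(ltW poisson_zero_mass_gt0) //.
by case: ifP => // _; have /andP[] := no_short_cycle_ge0_le1 R M (n - weight_upto M c).
Qed.

Lemma tilt_le n c : tilt n c <= poisson_zero_mass^-1.
Proof.
rewrite ler_piMr ?invr_ge0 ?(ltW poisson_zero_mass_gt0) //.
by case: ifP => // _; have /andP[] := no_short_cycle_ge0_le1 R M (n - weight_upto M c).
Qed.

(* [tilt n] is the density, with respect to the Poisson law, of the law of the
   first [M] cycle counts of a uniform permutation of [n] points. *)
Lemma integral_tilt n (h : (nat -> nat) -> R) : depends_upto M h ->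
  (\int[P]_w (h (counts w) * tilt n (counts w))%:E)%E = (E n h)%:E.
Proof.
move=> hdep; pose pat (k : {ffun 'I_M -> 'I_n.+1}) := pattern (fun i => k i).
pose g c := h c * tilt n c.
have gdep : depends_upto M g.
  by move=> c c' e; rewrite /g (hdep _ _ e) (depends_upto_tilt n e).
(* Patterns bounded by [n] are enough: if some count exceeds [n], so does the weight, and [tilt n]
   vanishes. *)
have gE w : (g (counts w))%:E = (\sum_k
    (g (pat k))%:E * (\1_(pattern_event (pat k)) w)%:E)%E.
  rewrite (eq_bigr (fun k => (g (pat k) * (same_upto M (counts w) (pat k))%:R)%:E));
    last first.
    move=> k _; rewrite EFinM indicE; congr (_ * (_%:R)%:E)%E.
    by congr nat_of_bool; apply/idP/idP; rewrite inE.
  rewrite sumEFin; congr (_%:E).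
  have [wn|] := boolP [forall i : 'I_M, (counts w i.+1 <= n)%N].
    by apply: sum_patterns => // i; exact: (forallP wn).
  rewrite negb_forall => wn; case: (fintype.existsP wn) => i.
  rewrite -ltnNge => wi; rewrite big1.
    rewrite /g /tilt leqNgt (leq_trans wi) /= ?mulr0 //.
    by rewrite /weight_upto (bigD1 i) //= mulSn -addnA leq_addr.
  move=> k _; rewrite (_ : same_upto _ _ _ = false) ?mulr0 //.
  apply/negbTE/negP => /forallP/(_ i); rewrite /pat patternE => /eqP wk.
  by move: wi; rewrite wk ltnNge -ltnS ltn_ord.
transitivity (\int[P]_w (\sum_k
    (g (pat k))%:E * (\1_(pattern_event (pat k)) w)%:E))%E.
  by apply: eq_integral => w _; rewrite -gE.
rewrite integral_sum //; last first.
  move=> k; apply: integrableZl => //; apply: integrable_indic.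
  exact: measurable_pattern_event.
rewrite (eq_bigr (fun k => (h (pat k) * E n (fun c => (same_upto M c (pat k))%:R))%:E)).
  rewrite sumEFin; congr (_%:E).
  rewrite (eq_bigr (fun k => E n (fun c => h (pat k) * (same_upto M c (pat k))%:R)));
    last by move=> k _; rewrite perm_meanZ.
  rewrite -perm_mean_sum; apply: eq_perm_mean => p; rewrite -sum_patterns // => i.
  rewrite (leq_trans (subset_leq_card (_ : _ \subset porbits p))) //.
    by apply/fintype.subsetP => c; rewrite inE => /andP[].
  by rewrite -[X in (_ <= X)%N]card_ord leq_imset_card.
move=> k _; rewrite integralZl //; last first.
  by apply: integrable_indic; exact: measurable_pattern_event.
rewrite integral_indic //; last exact: measurable_pattern_event.
rewrite setIT [X in (_ * X)%E]probability_pattern_event perm_mean_same_upto -EFinM /g /tilt.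
congr (_%:E); have := poisson_zero_mass_gt0; move: poisson_zero_mass => q q0.
by case: ifP => _; field; rewrite gt_eqF.
Qed.

Lemma cvg_tilt_lim c :
  tilt n c @[n --> \oo] --> poisson_zero_mass^-1 * limn (no_short_cycle R M).
Proof.
apply: cvgM; first exact: cvg_cst.
rewrite -(cvg_shiftn (weight_upto M c)) /=.
rewrite (_ : (fun n => _) = no_short_cycle R M); last first.
  by apply/funext => n; rewrite leq_addl addnK.
exact: cvgn_no_short_cycle.
Qed.

Lemma cvg_integral_tilt (h : (nat -> nat) -> R) (B : R) : depends_upto M h ->
  (forall c, `|h c| <= B) ->
  (\int[P]_w (h (counts w) * tilt n (counts w))%:E)%E @[n --> \oo] -->
  (\int[P]_w (h (counts w) *
     (poisson_zero_mass^-1 * limn (no_short_cycle R M)))%:E)%E.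
Proof.
move=> hdep hB; apply: (@dominated_cvg _ _ _ P setT measurableT _ _
  (fun=> (B * poisson_zero_mass^-1)%:E)) => //.
- move=> n; apply/measurable_EFinP.
  apply: (@measurable_depends_upto _ _ (fun c => h c * tilt n c)).
  by move=> c c' e; rewrite (hdep _ _ e) (depends_upto_tilt n e).
- move=> w _; apply: cvg_EFin; first by near=> n.
  by apply: cvgM; [exact: cvg_cst|exact: cvg_tilt_lim].
- exact: finite_measure_integrable_cst.
- move=> n w _; rewrite lee_fin normrM ler_pM //.
  by rewrite ger0_norm ?tilt_ge0 // tilt_le.
Unshelve. all: by end_near. Qed.

(** Take [h = 1]: every integral is 1, a mean of 1 over permutations, so the constant limit density
    also integrates to 1. *)
Lemma limn_no_short_cycle :
  poisson_zero_mass^-1 * limn (no_short_cycle R M) = 1.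
Proof.
have dep1 : depends_upto M (fun=> 1 : R) by [].
have bnd1 (c : nat -> nat) : `|1 : R| <= 1 by rewrite normr1.
have := cvg_integral_tilt dep1 bnd1.
rewrite (_ : (fun n => \int[P]_w (1 * tilt n (counts w))%:E)%E = fun=> 1%:E);
  last by apply/funext => n; rewrite (integral_tilt n dep1) perm_mean_cst.
under eq_integral do rewrite mul1r.
rewrite integral_cst // => /cvg_lim; rewrite lim_cst // => /(_ (@ereal_hausdorff R)).
by rewrite /= probability_setT mule1 => -[].
Qed.

Lemma cvg_tilt c : tilt n c @[n --> \oo] --> (1 : R).
Proof. by rewrite -limn_no_short_cycle; exact: cvg_tilt_lim. Qed.

Lemma cvg_perm_mean (h : (nat -> nat) -> R) (B : R) : depends_upto M h ->
  (forall c, `|h c| <= B) ->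
  (E n h)%:E @[n --> \oo] --> (\int[P]_w (h (counts w))%:E)%E.
Proof.
move=> hdep hB; have := cvg_integral_tilt hdep hB.
rewrite limn_no_short_cycle; under eq_integral do rewrite mulr1.
rewrite (_ : (fun n => \int[P]_w (h (counts w) * tilt n (counts w))%:E)%E =
  (fun n => (E n h)%:E)) //.
by apply/funext => n; exact: integral_tilt.
Qed.

End fixed_level.

(** Fatou's lemma along the densities [tilt m.+1 n], which tend to 1, bounds the mean by the limit
    of E_n[C_{m+1}], and the Palm formula evaluates this as 1/(m + 1) for n > m. *)
Lemma integral_count_le1 m : (\int[P]_w (Y m.+1 w)%:R%:E <= 1%:E)%E.
Proof.
pose h (c : nat -> nat) : R := (c m.+1)%:R.
have hdep : depends_upto m.+1 h.
  by move=> c c' /forallP/(_ ord_max)/eqP /= e; rewrite /h e.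
pose F n w := (h (counts w) * tilt m.+1 n (counts w))%:E.
have mF n : measurable_fun setT (F n).
  apply/measurable_EFinP.
  apply: (@measurable_depends_upto m.+1 _ _ (fun c => h c * tilt m.+1 n c)).
  by move=> c c' e; rewrite (hdep _ _ e) (depends_upto_tilt n e).
have F0 n w : setT w -> (0 <= F n w)%E.
  by move=> _; rewrite lee_fin mulr_ge0 ?tilt_ge0.
have := @fatou _ _ _ P setT measurableT _ mF F0.
rewrite (eq_integral (fun w => (Y m.+1 w)%:R%:E)); last first.
  move=> w _; suff /cvg_limn_einf_sup[-> _] : F n w @[n --> \oo] --> (h (counts w))%:E.
    by [].
  apply: cvg_EFin; first by near=> n.
  by rewrite -[X in _ --> X]mulr1; apply: cvgM; [exact: cvg_cst|exact: cvg_tilt].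
move/le_trans; apply.
have -> : (fun n => \int[P]_(w in setT) F n w)%E =
    (fun n => (E n h)%:E).
  by apply/funext => n; exact: integral_tilt.
have Eh : \forall n \near \oo, (E n h)%:E = (m.+1%:R^-1 : R)%:E.
  exists m.+1 => // n /= mn; congr (_%:E).
  apply: (@mulfI _ m.+1%:R); first by rewrite pnatr_eq0.
  rewrite mulfV ?pnatr_eq0 // (@eq_perm_mean _ _ h (fun c => (c m.+1)%:R * 1)).
    by rewrite (perm_mean_palm n m (fun=> 1)) mn perm_mean_cst.
  by move=> p; rewrite mulr1.
have /cvg_limn_einf_sup[-> _] : (E n h)%:E @[n --> \oo] --> (m.+1%:R^-1 : R)%:E.
  exact: cvg_near_cst.
by rewrite lee_fin invf_le1 ?ltr0n // ler1n.
Unshelve. all: by end_near. Qed.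

End poisson_counts.

(** * Convergence in distribution *)

Lemma expectation_uniform_permutation (R : realType) (n : nat)
    (d : measure_display) (T : measurableType d) (P : probability T R)
    (sigma : T -> 'S_n) (G : 'S_n -> R) : uniform_permutation P sigma ->
  'E_P[G \o sigma]%E = ((n`!%:R)^-1 * \sum_(p : 'S_n) G p)%:E.
Proof.
move=> unif; rewrite unlock.
transitivity (\int[P]_w (\sum_(p : 'S_n)
    (G p)%:E * (\1_(sigma @^-1` [set p]) w)%:E))%E.
  apply: eq_integral => w _; rewrite (bigD1 (sigma w)) //= indicE mem_set // mule1.
  rewrite big1 ?adde0 // => p pw; rewrite indicE memNset ?mule0 //=.
  by move=> e; rewrite e eqxx in pw.
have mS p : measurable (sigma @^-1` [set p]) by case: (unif p).
rewrite integral_sum //; last first.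
  by move=> p; apply: integrableZl => //; exact: integrable_indic.
rewrite mulr_sumr -sumEFin; apply: eq_bigr => p _.
rewrite integralZl //; last exact: integrable_indic.
rewrite integral_indic // setIT [X in (_ * X)%E](proj2 (unif p)).
by rewrite -EFinM mulrC.
Qed.

(** * Almost sure convergence of the Poisson series *)

Section almost_sure_convergence.
Context (R : realType) (d : measure_display) (T : measurableType d)
  (P : probability T R) (Y : nat -> {RV P >-> nat}).
Hypothesis Y_indep : mutually_independent [set m : nat | (0 < m)%N] Y.
Hypothesis Y_poisson : forall m : nat, (0 < m)%N ->
  poisson_distributed (Y m) (m%:R^-1).

(** Each count has mean at most 1, so the weighted sum has finite expectation and is finite almost
    everywhere. *)
Lemma ae_cvg_weighted_counts (b : nat -> R) : (forall i, 0 <= b i) ->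
  cvgn (series b) ->
  exists A : set T, [/\ measurable A, P (~` A) = 0%E &
    forall w, A w -> cvgn (series (fun i => b i * (Y i.+1 w)%:R))].
Proof.
move=> b0 cb.
pose F i w := (b i * (Y i.+1 w)%:R)%:E.
have mY i : measurable_fun setT (fun w => (Y i.+1 w)%:R%:E : \bar R).
  apply/measurable_EFinP.
  apply: (@measurable_depends_upto _ _ _ _ Y i.+1 _ _ (fun c => (c i.+1)%:R : R)).
  by move=> c c' /forallP/(_ ord_max)/eqP /= ->.
have F0 i w : (0 <= F i w)%E by rewrite lee_fin mulr_ge0.
have mF i : measurable_fun setT (F i).
  by rewrite /F; under eq_fun do rewrite EFinM; apply: emeasurable_funM.
have iF : P.-integrable setT (fun w => \sum_(i <oo) F i w)%E.
  apply/integrableP; split.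
    by apply: ge0_emeasurable_sum => // i w _ _; exact: F0.
  under eq_integral do rewrite gee0_abs ?nneseries_ge0 //.
  rewrite integral_nneseries //.
  apply: (@le_lt_trans _ _ (\sum_(i <oo) (b i)%:E)%E).
    apply: lee_nneseries => i _; first by move=> _; apply: integral_ge0.
    rewrite /F; under eq_integral do rewrite EFinM.
    rewrite ge0_integralZl //; last by rewrite lee_fin.
    rewrite -[leRHS]mule1 lee_wpmul2l ?lee_fin //.
    exact: integral_count_le1.
  rewrite (_ : (\sum_(i <oo) (b i)%:E)%E = (limn (series b))%:E) ?ltry //.
  rewrite -EFin_lim //; congr (limn _).
  by apply/funext => n /=; rewrite /series /= sumEFin.
have [N [mN N0 FN]] := integrable_ae measurableT iF.
exists (~` N); split; [exact: measurableC|by rewrite setCK|].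
move=> w Nw.
have Fw : (\sum_(i <oo) F i w)%E \is a fin_num.
  by apply: contrapT => h; apply: Nw; apply: FN => /= /(_ I).
apply: nondecreasing_is_cvgn.
  by apply/nondecreasing_series => i _ _; rewrite mulr_ge0.
exists (fine (\sum_(i <oo) F i w)%E) => _ [n _ <-].
rewrite -lee_fin fineK // /series /= -sumEFin.
by apply: nneseries_lim_ge => i _ _; exact: F0.
Qed.

End almost_sure_convergence.

Lemma cvgn_cycle_sum (R : realType) (L : nat -> R[i]) (c : nat -> nat) :
  cvgn (series (fun i => Normc.normc (L i) * (c i.+1)%:R)) ->
  cvgn (fun n => cycle_sum L n c).
Proof.
move=> cL.
have cvg_part (g : R[i] -> R) : (forall z, `|g z| <= Normc.normc z) ->
    cvgn (series (fun i => g ((c i.+1)%:R * L i))).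
  move=> gle; apply: normed_cvg; apply: series_le_cvg cL => i.
  - exact: normr_ge0.
  - by rewrite mulr_ge0 ?normc_ge0.
  - by rewrite (le_trans (gle _)) // Normc.normcM normc_natr mulrC.
apply/cvg_ex; exists (limn (series (fun i => complex.Re ((c i.+1)%:R * L i))) +i*
  limn (series (fun i => complex.Im ((c i.+1)%:R * L i)))).
rewrite (_ : (fun n => _) = fun n =>
  series (fun i => complex.Re ((c i.+1)%:R * L i)) n +i*
  series (fun i => complex.Im ((c i.+1)%:R * L i)) n).
  apply: cvg_Complex; apply: cvg_part; [exact: ler_abs_Re|exact: ler_abs_Im].
apply/funext => n; rewrite /cycle_sum /series /= !big_mkord.
elim: n => [|n IH]; first by rewrite !big_ord0.
by rewrite !big_ord_recr /= IH; case: (_ * _).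
Qed.

(** Interchange of the limits in [n] and [M], allowed because the error [|a n - u M n|] is small
    uniformly in [n]. *)
Lemma cvgn_uniform_approx (R : realType) (u : nat -> nat -> R) (a i_ : R^nat)
    (j : R) :
  (forall M, u M n @[n --> \oo] --> i_ M) -> i_ @ \oo --> j ->
  (forall e : R, 0 < e -> exists M0, forall M n, (M0 <= M)%N ->
     `|a n - u M n| <= e) ->
  a @ \oo --> j.
Proof.
move=> ui ij au; apply/cvgrPdist_lt => e e0.
have e40 : 0 < e / 4 by rewrite divr_gt0.
have [M0 hM0] := au _ e40.
have /cvgrPdist_lt/(_ _ e40)[M1 _ hM1] := ij.
pose M := maxn M0 M1.
have h1 := hM1 M (leq_maxr M0 M1).
have /cvgrPdist_lt/(_ _ e40) := ui M; apply: filterS => n h2.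
have h3 := hM0 M n (leq_maxl M0 M1).
have -> : j - a n = (j - i_ M) + (i_ M - u M n) - (a n - u M n) by ring.
move: h1 h2 h3; rewrite /=.
have := ler_normD (j - i_ M) (i_ M - u M n).
have := ler_normB ((j - i_ M) + (i_ M - u M n)) (a n - u M n).
lra.
Qed.

Section limit_law.
Context (R : realType) (d : measure_display) (T : measurableType d)
  (P : probability T R) (Y : nat -> {RV P >-> nat}).
Hypothesis Y_indep : mutually_independent [set m : nat | (0 < m)%N] Y.
Hypothesis Y_poisson : forall m : nat, (0 < m)%N ->
  poisson_distributed (Y m) (m%:R^-1).
Variables (L : nat -> R[i]) (X : T -> R[i]^o) (A : set T).
Hypothesis L_summable : cvgn (series (fun i => Normc.normc (L i))).
Hypotheses (mA : measurable A) (A0 : P (~` A) = 0%E).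
Hypothesis A_cvg : forall w, A w ->
  cycle_sum L n (counts Y w) @[n --> \oo] --> X w.

(** For each [M] the truncated means converge by [cvg_perm_mean], their limits converge by dominated
    convergence on [A], and the truncation error is uniform in [n]. *)
Lemma cvg_perm_mean_cycle_sum (f : R[i]^o -> R) : continuous f ->
  bounded_fun f ->
  (perm_mean n (f \o cycle_sum L n))%:E @[n --> \oo] --> 'E_P[f \o X]%E.
Proof.
move=> cf [B0 [_ /(_ (B0 + 1))]]; rewrite ltrDl ltr01 => /(_ isT) fB.
have {}fB z : `|f z| <= B0 + 1 by exact: fB.
set B := B0 + 1 in fB.
rewrite unlock (integral_conull mA A0).
pose h M := f \o cycle_sum L M.
have hdep M : depends_upto M (h M).
  move=> c c' /forallP cc'; rewrite /h /= /cycle_sum; congr f.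
  by apply: eq_bigr => i _; rewrite (eqP (cc' i)).
have mh M : measurable_fun setT (fun w => (h M (counts Y w))%:E).
  by apply/measurable_EFinP; exact: (measurable_depends_upto _ (hdep M)).
have hX w : A w -> (h M (counts Y w))%:E @[M --> \oo] --> (f (X w))%:E.
  move=> Aw; apply: cvg_EFin; first by near=> M.
  exact: (cvg_comp _ _ (A_cvg Aw) (cf _)).
(* [X] is arbitrary outside [A]; on [A] it is a pointwise limit of functions of finitely many
   counts, which makes [f \o X] measurable there. *)
have mX : measurable_fun A (fun w => (f (X w))%:E).
  apply: (@measurable_realfun.emeasurable_fun_cvg _ _ _ _
    (fun M w => (h M (counts Y w))%:E)) => //.
  by move=> M; exact: measurable_funTS.
have bounded_int (D : set T) (g : T -> R) : measurable D ->
    measurable_fun D (EFin \o g) -> (forall w, `|g w| <= B) ->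
    (\int[P]_(w in D) (g w)%:E)%E \is a fin_num.
  move=> mD mg gB; apply: integrable_fin_num => //.
  apply: (@le_integrable _ _ _ P D mD _ (EFin \o cst B)) => //.
    by move=> w _; rewrite lee_fin (le_trans (gB w)) // ler_norm.
  exact: finite_measure_integrable_cst.
have JX : (\int[P]_(w in A) (f (X w))%:E)%E \is a fin_num.
  exact: bounded_int.
have IM M : (\int[P]_w (h M (counts Y w))%:E)%E \is a fin_num.
  exact: (@bounded_int setT (fun w => h M (counts Y w)) measurableT (mh M)
    (fun w => fB _)).
rewrite -(fineK JX); apply: cvg_EFin; first by near=> n.
apply: (@cvgn_uniform_approx _ (fun M n => perm_mean n (h M)) _
  (fun M => fine (\int[P]_w (h M (counts Y w))%:E)%E)).
- move=> M; suff /fine_cvgP[] : (perm_mean n (h M))%:E @[n --> \oo] -->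
    (fine (\int[P]_w (h M (counts Y w))%:E))%:E by [].
  by rewrite fineK //; exact: (cvg_perm_mean Y_indep Y_poisson (hdep M) (fun c => fB _)).
- suff /fine_cvgP[] : (\int[P]_w (h M (counts Y w))%:E)%E @[M --> \oo] -->
      (fine (\int[P]_(w in A) (f (X w))%:E))%:E by [].
  rewrite fineK //.
  under eq_fun do rewrite (integral_conull mA A0).
  apply: (@dominated_cvg _ _ _ P A mA _ _ (fun=> B%:E)) => //.
  + by move=> M; exact: measurable_funTS.
  + exact: finite_measure_integrable_cst.
  + by move=> M w _; rewrite lee_fin; exact: fB.
- by move=> e e0; have := truncation_error L_summable cf fB e0.
Unshelve. all: by end_near. Qed.

End limit_law.

(** * The logarithmic sums and the products as weighted cycle sums *)

Section log_sums.
Variable R : realType.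
Implicit Types (x s : R[i]) (c : nat -> nat).

Lemma log_sumE x c n :
  log_sum x c n = cycle_sum (fun i => cLog (1 - x ^+ i.+1)) n c.
Proof. by rewrite /log_sum big_add1 big_mkord. Qed.

Lemma scaled_log_sumE s x c n :
  s * log_sum x c n = cycle_sum (fun i => s * cLog (1 - x ^+ i.+1)) n c.
Proof.
by rewrite log_sumE /cycle_sum mulr_sumr; apply: eq_bigr => i _; rewrite mulrCA.
Qed.

(** [cpow] is the exponential of a multiple of [cLog], so no branch has to be chosen for the
    product. *)
Lemma pow_prodE s x c n : pow_prod s x c n = cexp (s * log_sum x c n).
Proof.
rewrite /log_sum mulr_sumr cexp_sum; apply: eq_bigr => m _.
by rewrite /cpow mulrA.
Qed.

(** Comparison with the geometric series of ratio r = |x|, by [normc_cLog1B] and 1 - r^m >= 1 - r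
    for m >= 1. *)
Lemma cLog_summable x : `|x| < 1 ->
  cvgn (series (fun i => Normc.normc (cLog (1 - x ^+ i.+1)))).
Proof.
rewrite complex_normr ltcR; set r := Normc.normc x => r1.
have r0 : 0 <= r by exact: normc_ge0.
apply: (@series_le_cvg _ _ (fun i => 2 * r / (1 - r) * r ^+ i)).
- by move=> i; exact: normc_ge0.
- by move=> i; rewrite mulr_ge0 ?exprn_ge0 // divr_ge0 ?mulr_ge0 // subr_ge0 ltW.
- move=> i; have ri : r ^+ i.+1 <= r by rewrite exprS ler_piMr // exprn_ile1 // ltW.
  have := @normc_cLog1B _ (x ^+ i.+1); rewrite normcX -/r.
  move=> /(_ (le_lt_trans ri r1)) /le_trans; apply.
  rewrite exprS -!mulrA ler_wpM2l // ler_wpM2l //.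
  rewrite [leRHS]mulrC ler_wpM2l ?exprn_ge0 // lef_pV2 ?posrE ?subr_gt0 //.
    by rewrite lerB // -exprS.
  by rewrite -exprS (le_lt_trans ri).
- by apply: is_cvg_geometric_series; rewrite ger0_norm.
Qed.

End log_sums.

Theorem lemma3p14 (R : realType)
    (d : nat -> measure_display) (T : forall n : nat, measurableType (d n))
    (P : forall n : nat, probability (T n) R)
    (sigma : forall n : nat, T n -> 'S_n)
    (sigma_unif : forall n : nat, uniform_permutation (P n) (sigma n))
    (d' : measure_display) (T' : measurableType d') (P' : probability T' R)
    (Y : nat -> {RV P' >-> nat})
    (Y_indep : mutually_independent [set m : nat | (0 < m)%N] Y)
    (Y_poisson : forall m : nat, (0 < m)%N ->
       poisson_distributed (Y m) (m%:R^-1))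
    (x s : R[i]) (x_lt1 : `|x| < 1) :
  cvg_in_distribution P
    (fun n (w : T n) => s * log_sum x (ncycles (sigma n w)) n : R[i]^o)
    P'
    (fun w : T' => s * log_series x (fun m => Y m w) : R[i]^o) /\
  cvg_in_distribution P
    (fun n (w : T n) => pow_prod s x (ncycles (sigma n w)) n)
    P'
    (fun w : T' => pow_infprod s x (fun m => Y m w)).
Proof.
pose l (i : nat) := cLog (1 - x ^+ i.+1); pose L i := s * l i.
have l_sum : cvgn (series (fun i => Normc.normc (l i))) := cLog_summable x_lt1.
have L_sum : cvgn (series (fun i => Normc.normc (L i))).
  rewrite (_ : series _ = Normc.normc s \*: series (fun i => Normc.normc (l i))).
    exact: is_cvgZr.
  apply/funext => n; rewrite /series /= /GRing.scale /= mulr_sumr.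
  by apply: eq_bigr => i _; rewrite Normc.normcM.
(* The weights come from [l] rather than [L]: the limit in [log_series] is taken before the
   multiplication by [s], which may be 0. *)
have [A [mA A0 A_cvg]] := ae_cvg_weighted_counts Y_indep Y_poisson
  (fun i => normc_ge0 (l i)) l_sum.
have S_cvg w : A w -> cycle_sum L n (counts Y w) @[n --> \oo] -->
    (s * log_series x (fun m => Y m w) : R[i]^o).
  move=> Aw; rewrite (_ : (fun n => _) = fun n => s * log_sum x (counts Y w) n).
    apply: (@cvgMr R[i]); rewrite /log_series.
    rewrite (_ : log_sum _ _ = fun n => cycle_sum l n (counts Y w)).
      exact: cvgn_cycle_sum (A_cvg w Aw).
    by apply/funext => n; rewrite log_sumE.
  by apply/funext => n; rewrite scaled_log_sumE.
pose X n (w : T n) : R[i]^o := s * log_sum x (ncycles (sigma n w)) n.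
pose Xlim (w : T') : R[i]^o := s * log_series x (fun m => Y m w).
have mean_eq (f : R[i]^o -> R) n :
    'E_(P n)[f \o X n]%E =
    (perm_mean n (f \o cycle_sum L n))%:E.
  rewrite -(expectation_uniform_permutation _ (sigma_unif n)).
  congr ('E_ _ [ _ ])%E; apply/funext => w /=.
  by rewrite /X scaled_log_sumE.
split=> f cf bf.
  under eq_fun do rewrite mean_eq.
  exact: (cvg_perm_mean_cycle_sum Y_indep Y_poisson L_sum mA A0 S_cvg cf bf).
(* The second claim follows from the same limit law with the test function [f \o cexp]. *)
have cfe : continuous (f \o (@cexp R : R[i]^o -> R[i]^o)).
  by move=> z; apply: continuous_comp; [exact: continuous_cexp|exact: cf].
have bfe : bounded_fun (f \o (@cexp R : R[i]^o -> R[i]^o)).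
  by case: bf => B [Br fB]; exists B; split => // M BM z _; exact: fB.
(* Off [A] the limit in [pow_infprod] may be a default value, so both expectations are restricted to
   [A], where the product converges to the exponential of the sum. *)
have -> : 'E_P'[f \o (fun w => pow_infprod s x (fun m => Y m w))]%E =
    'E_P'[(f \o @cexp R) \o Xlim]%E.
  rewrite unlock (integral_conull mA A0) [RHS](integral_conull mA A0).
  apply: eq_integral => w /set_mem Aw /=; congr (f _)%:E.
  rewrite /pow_infprod; apply: cvg_lim => //.
  under eq_fun do rewrite pow_prodE scaled_log_sumE.
  exact: (cvg_comp _ _ (S_cvg w Aw) (@continuous_cexp R _)).
rewrite (_ : (fun n => _) = fun n => (perm_mean n ((f \o @cexp R) \o cycle_sum L n))%:E).
  exact: (cvg_perm_mean_cycle_sum Y_indep Y_poisson L_sum mA A0 S_cvg cfe bfe).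
apply/funext => n; rewrite -(mean_eq (f \o @cexp R)).
by congr ('E_ _ [ _ ])%E; apply/funext => w /=; rewrite pow_prodE.
Qed.
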